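(* Let $L$ be a locally finite Lie algebra over a field of characteristic $0$. (i) If $L$ is semi-simple and $R=(M,L)$ is an arbitrary faithful representation of $L$ such that for every finite-dimensional subalgebra $A$ of $L$ there is a positive integer $n$ for which $MA^n$ has finite dimension, then the trace form $f(a,b)=\operatorname{tr}(a^Rb^R)$, $a,b\in L$, is non-degenerate. (ii) If for every finite set $x_1,\ldots,x_k\in L$ there is a finite-dimensional subalgebra $A$ of $L$ which contains these elements and satisfies $L(\operatorname{ad}A)^n\subset A$ for some positive integer $n$, and if the Killing form $K(a,b)=\operatorname{tr}\big((\operatorname{ad}a)(\operatorname{ad}b)\big)$ of $L$ is non-degenerate, then $L$ is semi-simple.
   Context: Linear transformations are written on the right; $\operatorname{ad}a$ is the map $x\mapsto[x,a]$ of $L$. A Lie algebra is locally finite if every finite subset is contained in a finite-dimensional subalgebra; locally solvable if every finite subset is contained in a solvable subalgebra; semi-simple if it has no non-zero locally solvable ideals. A representation $R=(M,L)$ is a homomorphism $x\mapsto x^R$ of $L$ into the Lie algebra of linear transformations of a (possibly infinite-dimensional) vector space $M$; it is faithful if its kernel is $0$. $MA^n$ is the linear span of all $xa_1^Ra_2^R\cdots a_n^R$ with $x\in M$, $a_i\in A$; $L(\operatorname{ad}A)^n$ is the linear span of all $[\ldots[[x,a_1],a_2],\ldots,a_n]$ with $x\in L$, $a_i\in A$. For a linear transformation $T$ of a vector space $V$ whose Fitting null component $V_{0T}=\{y\in V: yT^m=0\text{ for some positive integer }m\}$ has finite codimension, $\operatorname{tr}T$ is the trace of the transformation induced by $T$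 in $V/V_{0T}$. Under the hypothesis on $R$ in (i), respectively on $L$ in (ii), the transformations $a^Rb^R$, respectively $(\operatorname{ad}a)(\operatorname{ad}b)$, have Fitting null components of finite codimension, so $f$ and $K$ are well-defined symmetric bilinear forms on $L$. A symmetric bilinear form $f$ on $L$ is non-degenerate if $f(a,z)=0$ for all $a\in L$ implies $z=0$. *)

(* Defs.v *)
From HB Require Import structures.
From mathcomp Require Import all_boot all_order all_algebra.
From mathcomp Require Import boolp classical_sets.

Set Implicit Arguments.
Unset Strict Implicit.
Unset Printing Implicit Defensive.

Import GRing.Theory.
Local Open Scope classical_set_scope.
Local Open Scope ring_scope.

(* Linear algebra in arbitrary (possibly infinite-dimensional) vector spaces;
   subspaces are sets. *)

Section LinearAlgebra.
Context {F : fieldType} {V : lmodType F}.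
Implicit Types (S W : set V) (T : {linear V -> V}).

Definition lin_span S : set V :=
  [set v | exists (n : nat) (c : 'I_n -> F) (e : 'I_n -> V),
     (forall i, S (e i)) /\ v = \sum_i c i *: e i].

Definition subspace W : Prop :=
  W 0 /\ forall (c : F) x y, W x -> W y -> W (c *: x + y).

Definition finite_dim W : Prop :=
  exists s : seq V, W = lin_span [set x | x \in s].

(* The classes of the e i modulo W form a basis of V / W. *)
Definition basis_mod W (n : nat) (e : 'I_n -> V) : Prop :=
  (forall v, exists c : 'I_n -> F, W (v - \sum_i c i *: e i)) /\
  (forall c : 'I_n -> F, W (\sum_i c i *: e i) -> forall i, c i = 0).

(* For a T-invariant subspace W of finite codimension: t is the trace of the
   transformation induced by T in V / W, computed from its matrix A in a basis
   of V / W given by representatives e i. *)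
Definition is_quotient_trace W T (t : F) : Prop :=
  exists (n : nat) (e : 'I_n -> V) (A : 'M[F]_n),
    [/\ basis_mod W e,
        forall i, W (T (e i) - \sum_j A i j *: e j)
      & t = \tr A].

Definition fitting_null T : set V :=
  [set y | exists2 m : nat, (0 < m)%N & iter m T y = 0].

(* Junk value 0 when the Fitting null component has infinite codimension. *)
Definition fitting_trace T : F :=
  xget 0 [set t | is_quotient_trace (fitting_null T) T t].

End LinearAlgebra.

HB.mixin Record isLieAlgebra (F : fieldType) L of GRing.Lmodule F L := {
  lie : L -> L -> L;
  lie_linearl : forall (c : F) (x y z : L),
    lie (c *: x + y) z = c *: lie x z + lie y z;
  lie_linearr : forall (c : F) (x y z : L),
    lie z (c *: x + y) = c *: lie z x + lie z y;
  liexx : forall x : L, lie x x = 0;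
  lie_jacobi : forall x y z : L,
    lie (lie x y) z + lie (lie y z) x + lie (lie z x) y = 0
}.

#[short(type="lieAlgType")]
HB.structure Definition LieAlgebra (F : fieldType) :=
  { L of isLieAlgebra F L & GRing.Lmodule F L }.

Section LieAlgebraTheory.
Context {F : fieldType} {L : lieAlgType F}.
Implicit Types (A B I : set L).

Lemma lieC (x y : L) : lie x y = - lie y x.
Proof.
have lieDl u v w : lie (u + v) w = lie u w + lie v w :> L.
  by rewrite -[u]scale1r lie_linearl !scale1r.
have lieDr u v w : lie w (u + v) = lie w u + lie w v :> L.
  by rewrite -[u]scale1r lie_linearr !scale1r.
apply/eqP; rewrite -addr_eq0; apply/eqP.
by have := liexx (x + y); rewrite lieDl !lieDr !liexx add0r addr0.
Qed.

Definition subalgebra A : Prop :=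
  subspace A /\ forall x y, A x -> A y -> A (lie x y).

Definition lie_ideal I : Prop :=
  subspace I /\ forall x y, I x -> I (lie x y).

Definition derived A : set L :=
  lin_span [set z | exists x y, [/\ A x, A y & z = lie x y]].

Definition solvable A : Prop := exists k : nat, iter k derived A = [set 0].

(* Local solvability of the subalgebra I, as a Lie algebra in its own right. *)
Definition locally_solvable I : Prop :=
  forall s : seq L, (forall x, x \in s -> I x) ->
    exists B, [/\ subalgebra B, B `<=` I, solvable B
                & forall x, x \in s -> B x].

Definition nondegenerate_form (f : L -> L -> F) : Prop :=
  forall z, (forall a, f a z = 0) -> z = 0.

End LieAlgebraTheory.

Definition locally_finite (F : fieldType) (L : lieAlgType F) : Prop :=
  forall s : seq L, exists A : set L,
    [/\ subalgebra A, finite_dim A & forall x, x \in s -> A x].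

Definition semisimple (F : fieldType) (L : lieAlgType F) : Prop :=
  forall I : set L, lie_ideal I -> locally_solvable I -> I = [set 0].

(* Transformations act on the right: x a^R is written rep a x, so the product
   a^R b^R (first a^R, then b^R) is the function rep b \o rep a, and the
   bracket of transformations is [S, T] = S T - T S for that product. *)
Record representation (F : fieldType) (L : lieAlgType F) (M : lmodType F) :=
  Representation {
    rep :> L -> {linear M -> M};
    rep_linear : forall (c : F) (a b : L) (x : M),
      rep (c *: a + b) x = c *: rep a x + rep b x;
    rep_lie : forall (a b : L) (x : M),
      rep (lie a b) x = rep b (rep a x) - rep a (rep b x)
  }.

Section Representations.
Context {F : fieldType} {L : lieAlgType F} {M : lmodType F}.
Context (R : representation L M).

Definition faithful : Prop := forall a : L, (forall x, R a x = 0) -> a = 0.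

(* The subspace M A^n. *)
Definition rep_pow (A : set L) (n : nat) : set M :=
  lin_span [set y | exists (x : M) (a : n.-tuple L),
    (forall i, A (tnth a i)) /\ y = foldl (fun z b => R b z) x a].

Definition trace_form (a b : L) : F :=
  fitting_trace (R b \o R a : {linear M -> M}).

End Representations.

Section Adjoint.
Context {F : fieldType} {L : lieAlgType F}.

Definition ad (a x : L) : L := lie x a.

Fact ad_is_linear (a : L) : linear (ad a).
Proof. by move=> c x y; rewrite /ad lie_linearl. Qed.

HB.instance Definition _ (a : L) :=
  GRing.isLinear.Build F L L *:%R (ad a) (ad_is_linear a).

Fact ad_linear_param (c : F) (a b x : L) :
  ad (c *: a + b) x = c *: ad a x + ad b x.
Proof. exact: lie_linearr. Qed.

Fact ad_lie (a b x : L) : ad (lie a b) x = ad b (ad a x) - ad a (ad b x).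
Proof.
have lieNl (u v : L) : lie (- u) v = - lie u v by exact: (linearN (ad v)).
rewrite /ad.
have := lie_jacobi x a b; rewrite [lie (lie a b) x]lieC [lie b x]lieC lieNl.
move=> /eqP; rewrite addrAC addr_eq0 opprK => /eqP ->.
by [].
Qed.

Definition adjoint : representation L L :=
  Representation (rep := fun a => ad a : {linear L -> L}) ad_linear_param ad_lie.

Definition killing_form (a b : L) : F :=
  fitting_trace (ad b \o ad a : {linear L -> L}).

Fact killing_formE : killing_form = trace_form adjoint.
Proof. by []. Qed.

End Adjoint.

(* Main.v *)
From HB Require Import structures.
Require Import Defs.
From mathcomp Require Import all_boot all_order all_algebra all_field ring.
From mathcomp Require Import boolp classical_sets.

Set Implicit Arguments.
Unset Strict Implicit.
Unset Printing Implicit Defensive.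

Import GRing.Theory Num.Theory.
Local Open Scope classical_set_scope.
Local Open Scope ring_scope.

(** Both halves are reduced to matrices.  Let W be a finite-dimensional subspace
    of M, stable under a finite-dimensional subalgebra A and containing M A^n.
    For a, b in A some power of a^R b^R maps M into W, so the Fitting
    one-component of a^R b^R lies in W, and f(a, b) is the ordinary trace of
    the product of the matrices by which a and b act on W
    ([fitting_trace_represents], [trace_form_acts_as]).  Bilinearity, symmetry
    and invariance of f follow, since finitely many elements of L always lie in
    one such A.

    (i) By invariance the radical N of f is an ideal.  If A is a
    finite-dimensional subalgebra, B = A `&` N acts on W = M A^n by a Lie algebra
    of matrices with zero trace form, which is solvable by Cartan's criterion
    ([cartan_criterion]).  A term D of the derived series of B therefore kills
    W, so that M D^(n+1) = 0 and D, which acts faithfully, is solvable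
    ([nil_flag_solvable]).  Hence N is locally solvable, and N = 0 by
    semi-simplicity.

    (ii) Here W = A.  Let I be a locally solvable ideal.  Then A `&` I is a
    solvable ideal of A, and in characteristic 0 the commutator of a solvable
    ideal with a Lie algebra S of matrices lies in the radical of the
    associative algebra generated by S ([lie_solvable_ideal_trace_radical]).
    Hence K([z, a], b) = 0 for z in I and all a, b; non-degeneracy gives
    [z, a] = 0 for all a, thus ad z = 0, K(a, z) = 0 for all a, and z = 0.

    Cartan's criterion is proved over any field of characteristic 0.  After
    adjoining the eigenvalues of a matrix x in the derived algebra, x is
    compared with its replicas y, which act on each generalized eigenspace of
    x by a rational scalar depending additively on the eigenvalue: ad y is a
    polynomial in ad x, whence tr(x y) = 0, and this for all y forces the
    eigenvalues to vanish ([nilpotent_derived_split]).  Engel's theorem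
    ([engel]) then yields solvability.  The result on solvable ideals rests on
    Engel's theorem too, and on the fact that a matrix is nilpotent when all
    its positive powers have trace 0 ([nilpotent_mxtrace_expr]). *)

(** * Subspaces and spans *)
Section Spans.
Context {F : fieldType} {V : lmodType F}.
Implicit Types (S W : set V).

Lemma subspaceD W x y : subspace W -> W x -> W y -> W (x + y).
Proof. by move=> [_ lW] Wx Wy; rewrite -[x]scale1r; apply: lW. Qed.

Lemma subspaceZ W c x : subspace W -> W x -> W (c *: x).
Proof. by move=> [W0 lW] Wx; rewrite -[_ *: _]addr0; apply: lW. Qed.

Lemma subspaceB W x y : subspace W -> W x -> W y -> W (x - y).
Proof.
by move=> sW Wx Wy; rewrite -scaleN1r; apply: subspaceD => //; apply: subspaceZ.
Qed.

Lemma subspace_sum W (I : Type) (r : seq I) (P : pred I) (f : I -> V) :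
  subspace W -> (forall i, P i -> W (f i)) -> W (\sum_(i <- r | P i) f i).
Proof.
move=> sW Wf; apply: (big_ind W) => //; first by case: sW.
by move=> x y; apply: subspaceD.
Qed.

Lemma sub_lin_span S : S `<=` lin_span S.
Proof.
move=> x Sx; exists 1%N, (fun=> 1), (fun=> x); split=> //.
by rewrite big_ord1 scale1r.
Qed.

Lemma subspace_lin_span S : subspace (lin_span S).
Proof.
split; first by exists 0, (fun=> 0), (fun=> 0); split; [case|rewrite big_ord0].
move=> c _ _ [m [a [e [Se ->]]]] [n [b [g [Sg ->]]]].
exists (m + n)%N, (fun i => match split i with inl j => c * a j | inr j => b j end),
  (fun i => match split i with inl j => e j | inr j => g j end); split.
  by move=> i; case: split.
rewrite big_split_ord scaler_sumr; congr (_ + _); apply: eq_bigr => i _.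
  by rewrite (unsplitK (inl i)) scalerA.
by rewrite (unsplitK (inr i)).
Qed.

Lemma lin_span_sub S W : subspace W -> S `<=` W -> lin_span S `<=` W.
Proof.
move=> sW SW _ [n [c [e [Se ->]]]]; apply: subspace_sum => // i _.
by apply: subspaceZ => //; apply: SW.
Qed.

Lemma lin_span_mono S1 S2 : S1 `<=` S2 -> lin_span S1 `<=` lin_span S2.
Proof.
move=> S12; apply: lin_span_sub; first exact: subspace_lin_span.
by move=> x /S12; apply: sub_lin_span.
Qed.

Lemma subspace_preimage (U : lmodType F) (f : {linear U -> V}) W :
  subspace W -> subspace (f @^-1` W).
Proof.
move=> [W0 lW]; split=> [|c x y Wx Wy]; rewrite /preimage/= ?linear0 //.
by rewrite linearP; apply: lW.
Qed.

Lemma subspace_set0 : subspace [set (0 : V)].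
Proof. by split=> // c x y -> ->; rewrite scaler0 addr0. Qed.

Lemma subspace_setI W1 W2 : subspace W1 -> subspace W2 -> subspace (W1 `&` W2).
Proof.
move=> [? l1] [? l2]; split=> // c x y [? ?] [? ?].
by split; [apply: l1|apply: l2].
Qed.

End Spans.

(** In a finite-dimensional space a subspace of largest dimension contained
    in W is all of W, since otherwise a vector of W could be adjoined. *)
Lemma subspace_vspace (F : fieldType) (vT : vectType F) (W : set vT) :
  subspace W -> exists U : {vspace vT}, W = [set x | x \in U].
Proof.
move=> sW.
pose P n := `[< exists2 U : {vspace vT}, \dim U = n & [set x | x \in U] `<=` W >].
have P0 : exists n, P n.
  exists 0; apply/asboolP; exists 0%VS; first exact: dimv0.
  by move=> x /=; rewrite memv0 => /eqP ->; case: sW.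
have Pmax n : P n -> (n <= \dim {: vT})%N.
  by move/asboolP => [U <- _]; apply/dimvS/subvf.
case: (ex_maxnP P0 Pmax) => n /asboolP [U dU UW] nmax.
exists U; apply/seteqP; split=> // x Wx /=; apply: contrapT => /negP xU.
suff /nmax : P n.+1 by rewrite ltnn.
apply/asboolP; exists (U + <[x]>)%VS.
  have x0 : x != 0 by apply: contraNneq xU => ->; rewrite mem0v.
  rewrite dimv_disjoint_sum ?dU ?dim_vline ?x0 ?addn1 //.
  apply/eqP; rewrite -subv0; apply/subvP => y; rewrite memv_cap => /andP[yU].
  move=> /vlineP [k yk]; rewrite memv0 yk.
  have [->|k0] := eqVneq k 0; first by rewrite scale0r.
  case/negP: xU; rewrite -[x]scale1r -(mulVf k0) -scalerA -yk.
  exact: memvZ.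
move=> _ /memv_addP [u uU [_ /vlineP [k ->] ->]].
by apply: subspaceD => //; [exact: UW|exact: subspaceZ].
Qed.

(** * Matrices as a Lie algebra *)
Section MatrixLie.
Context {F : fieldType} {d : nat}.
Implicit Types X Y Z : 'M[F]_d.

Definition mxlie X Y : 'M[F]_d := X *m Y - Y *m X.

Fact mxlie_linearl (c : F) X Y Z :
  mxlie (c *: X + Y) Z = c *: mxlie X Z + mxlie Y Z.
Proof.
rewrite /mxlie mulmxDl mulmxDr -scalemxAl -scalemxAr scalerBr opprD !addrA.
by congr (_ - _); rewrite addrAC.
Qed.

Fact mxlie_linearr (c : F) X Y Z :
  mxlie Z (c *: X + Y) = c *: mxlie Z X + mxlie Z Y.
Proof.
rewrite /mxlie mulmxDl mulmxDr -scalemxAl -scalemxAr scalerBr opprD !addrA.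
by congr (_ - _); rewrite addrAC.
Qed.

Fact mxliexx X : mxlie X X = 0.
Proof. exact: subrr. Qed.

Fact mxlie_jacobi X Y Z :
  mxlie (mxlie X Y) Z + mxlie (mxlie Y Z) X + mxlie (mxlie Z X) Y = 0.
Proof.
rewrite /mxlie !mulmxBl !mulmxBr !mulmxA.
set a := X *m Y *m Z; set b := Y *m X *m Z; set c := Z *m X *m Y.
set e := Z *m Y *m X; set f := Y *m Z *m X; set g := X *m Z *m Y.
by apply/matrixP => i j; rewrite !mxE; ring.
Qed.

HB.instance Definition _ :=
  isLieAlgebra.Build F 'M[F]_d mxlie_linearl mxlie_linearr mxliexx mxlie_jacobi.

Lemma mxlieE X Y : lie X Y = X *m Y - Y *m X. Proof. by []. Qed.

Fact natrep_linear (c : F) X Y (v : 'rV[F]_d) :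
  v *m (c *: X + Y) = c *: (v *m X) + v *m Y.
Proof. by rewrite mulmxDr scalemxAr. Qed.

Fact natrep_lie X Y (v : 'rV[F]_d) :
  v *m lie X Y = (v *m X) *m Y - (v *m Y) *m X.
Proof. by rewrite mxlieE mulmxBr !mulmxA. Qed.

(** Row vectors with matrices on the right: this makes the bracket XY - YX
    agree with the convention of [representation]. *)
Definition natrep : representation 'M[F]_d 'rV[F]_d :=
  Representation (rep := fun X => mulmxr X : {linear 'rV[F]_d -> 'rV[F]_d})
    natrep_linear natrep_lie.

Lemma natrepE X v : natrep X v = v *m X. Proof. by []. Qed.

Lemma natrep_faithful : faithful natrep.
Proof.
move=> X X0; apply/row_matrixP => i; rewrite row0 rowE.
exact: X0.
Qed.

End MatrixLie.

(** * Traces of nilpotent and idempotent matrices *)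
Section MatrixTraces.
Context {F : fieldType}.

Definition nilpotent_mx (d : nat) (X : 'M[F]_d) : Prop :=
  exists k : nat, X ^+ k = 0.

(** A matrix of rank r factors as C R with r columns in C and r rows in R, and
    the smaller matrix R C has the same traces of positive powers.  This allows
    inductions on the size without eigenvalues. *)
Lemma expr_mulmx_swap (d r : nat) (C : 'M[F]_(d, r)) (R : 'M[F]_(r, d)) k :
  (C *m R) ^+ k.+1 = C *m (R *m C) ^+ k *m R.
Proof.
elim: k => [|k IHk]; first by rewrite expr1 expr0 mulmx1.
by rewrite exprSr IHk -[X in X = _]/(_ *m _) exprSr -!mulmxE !mulmxA.
Qed.

Lemma nilpotent_row_free (d : nat) (X : 'M[F]_d) :
  nilpotent_mx X -> row_free X -> X = 0.
Proof.
move=> [k Xk] fX.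
have X1 : (1 : 'M[F]_d) = 0.
  elim: k Xk => [|k IHk]; first by rewrite expr0.
  rewrite exprSr => Xk; apply: IHk.
  by apply: (row_free_inj fX); rewrite /= mulmxE Xk mul0r.
by rewrite -[X]mul1r X1 mul0r.
Qed.

Lemma nilpotent_mxtrace (d : nat) (X : 'M[F]_d) : nilpotent_mx X -> \tr X = 0.
Proof.
elim/ltn_ind: d X => d IHd X nX.
have [rd|] := ltnP (\rank X) d; last first.
  move=> rd; rewrite (nilpotent_row_free nX) ?mxtrace0 //.
  by rewrite /row_free eqn_leq rank_leq_row.
rewrite -(mulmx_base X) mxtrace_mulC; apply: IHd => //.
case: nX => k Xk; exists k.+1.
by rewrite expr_mulmx_swap mulmx_base Xk mulmx0 mul0mx.
Qed.

(** If E = C R is a full rank factorization, E E = E forces R C = 1. *)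
Lemma idempotent_mxtrace (d : nat) (E : 'M[F]_d) :
  E *m E = E -> \tr E = (\rank E)%:R.
Proof.
move=> EE; rewrite -{1}(mulmx_base E) mxtrace_mulC.
suff -> : row_base E *m col_base E = 1%:M by rewrite mxtrace1.
apply: (row_full_inj (col_base_full E)); apply: (row_free_inj (row_base_free E)).
by rewrite /= mulmx1 mulmxA mulmx_base -mulmxA mulmx_base.
Qed.

Lemma subspace_mxtrace_mull (d : nat) (y : 'M[F]_d) :
  subspace [set u : 'M[F]_d | \tr (u *m y) = 0].
Proof.
split=> [|c u v]; rewrite /= ?mul0mx ?mxtrace0 // => u0 v0.
by rewrite mulmxDl -scalemxAl linearD linearZ /= u0 v0 mulr0 addr0.
Qed.

Lemma natf_neq0_pchar0 : [pchar F] =i pred0 -> forall n, (n.+1%:R : F) != 0.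
Proof. by move/pcharf0P => c0 n; rewrite c0. Qed.

(** Singular matrices reduce to a smaller size; for an invertible X of positive
    size d, the trace of the Cayley-Hamilton identity is d det X = 0 up to
    sign, which is impossible in characteristic 0. *)
Lemma nilpotent_mxtrace_expr (d : nat) (X : 'M[F]_d) :
  [pchar F] =i pred0 -> (forall k, \tr (X ^+ k.+1) = 0) -> nilpotent_mx X.
Proof.
move=> char0; elim/ltn_ind: d X => d IHd X trX.
have [rd|rd] := ltnP (\rank X) d.
  move: (col_base X) (row_base X) (mulmx_base X) => C R XE.
  have [|k Xk] := IHd _ rd (R *m C).
    case=> [|k]; first by rewrite expr1 mxtrace_mulC XE -[X]expr1 trX.
    rewrite exprSr -mulmxE [_ *m (R *m C)]mulmxA mxtrace_mulC mulmxA.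
    by rewrite -expr_mulmx_swap XE trX.
  by exists k.+1; rewrite -XE expr_mulmx_swap Xk mulmx0 mul0mx.
case: d X {IHd} trX rd => [|d] X trX rd; first by exists 0; apply/matrixP; case.
have uX : row_free X by rewrite /row_free eqn_leq rank_leq_row.
have := Cayley_Hamilton X; set p := char_poly X.
rewrite -[p]coefK poly_def rmorph_sum /= => /(congr1 mxtrace).
rewrite mxtrace0 raddf_sum /= size_char_poly big_ord_recl big1 => [|i _]; last first.
  by rewrite linearZ /= rmorphXn /= horner_mx_X mxtraceZ trX mulr0.
rewrite addr0 linearZ /= expr0 rmorph1 mxtraceZ mxtrace1 => /eqP.
rewrite mulf_eq0 (negPf (natf_neq0_pchar0 char0 _)) orbF.
rewrite char_poly_det mulf_eq0 signr_eq0 /= => /eqP dX.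
by move: uX; rewrite row_free_unit unitmxE dX unitr0.
Qed.

End MatrixTraces.

(** * The flag of a set of linear transformations *)
Section Flags.
Context {F : fieldType} {L : lieAlgType F} {M : lmodType F}.
Variable R : representation L M.
Implicit Types C : set L.

Lemma rep0 v : R 0 v = 0.
Proof.
by have := rep_linear R (-1) 0 0 v; rewrite scaler0 addr0 scaleN1r addNr.
Qed.

(** The subspace M C^i again, but defined one factor at a time, the last factor
    first, so that statements about the flag go by induction. *)
Fixpoint flag C i : set M :=
  if i is j.+1 then
    lin_span [set y | exists v c, [/\ flag C j v, C c & y = R c v]]
  else setT.

Lemma subspace_flag C i : subspace (flag C i).
Proof. by case: i => [|i]; [split|apply: subspace_lin_span]. Qed.

Lemma flag_act C i v c : flag C i v -> C c -> flag C i.+1 (R c v).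
Proof. by move=> Cv Cc; apply: sub_lin_span; exists v, c. Qed.

Lemma flagS C i : flag C i.+1 `<=` flag C i.
Proof.
elim: i => [//|i IHi]; apply: lin_span_mono => _ [v [c [Cv Cc ->]]].
by exists v, c; split=> //; apply: IHi.
Qed.

Lemma flag_anti C i j : (i <= j)%N -> flag C j `<=` flag C i.
Proof.
move/subnK <-; elim: (j - i)%N => [//|k IHk].
exact: subset_trans (@flagS _ _) IHk.
Qed.

Lemma flag_sub_rep_pow C i : flag C i `<=` rep_pow R C i.
Proof.
elim: i => [|i IHi].
  by move=> v _; apply: sub_lin_span; exists v, [tuple]; split=> // -[].
apply: lin_span_sub; first exact: subspace_lin_span.
move=> _ [v [c [/IHi Cv Cc ->]]].
pose W := R c @^-1` rep_pow R C i.+1; suff: rep_pow R C i `<=` W by apply.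
apply: lin_span_sub; first exact/subspace_preimage/subspace_lin_span.
move=> _ [x [a [Ca ->]]]; apply: sub_lin_span; exists x, [tuple of rcons a c].
split; last by rewrite /= foldl_rcons.
move=> j; rewrite (tnth_nth c) /= nth_rcons size_tuple.
case: ltngtP => // ji.
by have := Ca (Ordinal ji); rewrite (tnth_nth c).
Qed.

(** v c a = (v a) c + v [c, a] moves a past one factor. *)
Lemma flag_normalizer C a i v : (forall c, C c -> C (lie c a)) ->
  flag C i v -> flag C i (R a v).
Proof.
move=> Ca; elim: i v => [//|i IHi] v.
pose W := R a @^-1` flag C i.+1; suff: flag C i.+1 `<=` W by apply.
apply: lin_span_sub; first exact/subspace_preimage/subspace_flag.
move=> _ [u [c [Cu Cc ->]]]; rewrite /W /preimage /=.
have -> : R a (R c u) = R c (R a u) + R (lie c a) u by rewrite rep_lie addrC subrK.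
by apply: subspaceD (@subspace_flag C i.+1) _ _; apply: flag_act; auto.
Qed.

(** The j-th derived algebra moves the flag by j + 1 steps, since a
    product of two elements moving it by j + 1 steps moves it by 2j + 2.  An
    element moving the flag beyond its length acts as 0. *)
Lemma nil_flag_solvable C k :
  faithful R -> flag C k `<=` [set 0] -> solvable C.
Proof.
move=> fR Ck.
have shift j z : iter j derived C z ->
    forall i v, flag C i v -> flag C (i + j.+1) (R z v).
  elim: j z => [|j IHj] z.
    by move=> Cz i v Cv; rewrite addn1; apply: flag_act.
  move=> Dz i v Cv; rewrite iterS in Dz.
  pose W := [set z | flag C (i + j.+2) (R z v)].
  suff: derived (iter j derived C) `<=` W by apply.
  apply: lin_span_sub.
    have [W0 lW] := @subspace_flag C (i + j.+2).
    split=> [|c a b Wa Wb]; rewrite /W /= ?rep0 // rep_linear.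
    exact: lW.
  move=> _ [a [b [Da Db ->]]]; rewrite /W /= rep_lie.
  have sub u : flag C (i + j.+1 + j.+1) u -> flag C (i + j.+2) u.
    by apply: flag_anti; rewrite -addnA leq_add2l addSnnS leq_addl.
  apply: subspaceB; first exact: subspace_flag.
    by apply/sub/IHj => //; apply: IHj.
  by apply/sub/IHj => //; apply: IHj.
exists k.+1; apply/seteqP; split=> z; last first.
  by move=> ->; have [] := @subspace_lin_span _ _
       [set z | exists x y, [/\ iter k derived C x, iter k derived C y & z = lie x y]].
move=> Dz; apply: fR => v; apply: Ck; apply: (@flag_anti _ _ (0 + k.+2)).
  by rewrite add0n ltnW.
exact: shift.
Qed.

End Flags.

(** * Engel's theorem *)
Section Engel.
Context {F : fieldType} {d : nat}.
Implicit Types (H : set 'M[F]_d) (X : 'M[F]_d).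

Local Notation mxflag := (flag (@natrep F d)).

(** Otherwise every element of H outside U has a bracket with some element of U
    that is again outside U, so that brackets can be taken indefinitely.  An
    arbitrary element moves the flag of U back by at most its length k, each
    bracket with U moves the result one step further, and an element moving
    the flag by k steps forward is 0. *)
Lemma nil_normalizer_proper H (U : {vspace 'M[F]_d}) k :
  subalgebra H -> [set x | x \in U] `<=` H ->
  mxflag [set x | x \in U] k `<=` [set 0] -> ~ H `<=` [set x | x \in U] ->
  exists x, [/\ H x, x \notin U & forall c, c \in U -> lie x c \in U].
Proof.
move=> [sH lH] UH Uk nHU; set C := [set x | x \in U] in UH Uk nHU.
apply: contrapT => nx.
have esc x : H x -> x \notin U -> exists2 c, c \in U & lie x c \notin U.
  move=> Hx xU; apply: contrapT => nc; apply: nx; exists x; split=> // c Uc.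
  by apply/negPn/negP => cU; apply: nc; exists c.
(* Negative degrees, truncated to 0, stand for the whole space as well. *)
pose shift n (m : 'M[F]_d) :=
  forall i v, mxflag C i v -> mxflag C (i + n - k) (v *m m).
have [y Hy yU] : exists2 y, H y & y \notin U.
  apply: contrapT => ny; apply: nHU => y Hy; apply/negPn/negP => yU.
  by apply: ny; exists y.
have all_shift n : exists m, [/\ H m, m \notin U & shift n m].
  elim: n => [|n [m [Hm mU Sm]]].
    exists y; split=> // i v; rewrite addn0.
    have [ik|/ltnW ki] := leqP i k; first by move: (ik) => /eqP ->.
    move=> /(flag_anti ki)/Uk ->; rewrite mul0mx.
    by have [] := subspace_flag natrep C (i - k).
  have [c Uc cU] := esc _ Hm mU.
  exists (lie m c); split=> // [|i v Cv]; first exact: lH (UH _ Uc).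
  rewrite natrep_lie; apply: subspaceB; first exact: subspace_flag.
    have /(flag_act (Sm _ _ Cv)) : C c by [].
    by apply: flag_anti; rewrite addnS leq_subLR addnS ltnS -leq_subLR.
  have /(flag_act Cv)/Sm : C c by [].
  by rewrite addSnnS.
(* Of the 2k brackets, k make up for the loss and k reach the end of the flag. *)
have [m [_ mU Sm]] := all_shift (k + k)%N.
case/negP: mU; suff -> : m = 0 by exact: mem0v.
apply: natrep_faithful => v; apply: Uk.
by have := Sm 0 v I; rewrite add0n addnK.
Qed.

(** As x normalizes C, it preserves each V_j = V C^j, so a word of length t in
    C and x maps V_j into V_j x^t + V_(j+1).  For x^m = 0, words of length m
    move the flag by one step. *)
Lemma nil_flag_adjoin (C : set 'M[F]_d) x k :
  mxflag C k `<=` [set 0] -> (forall c, C c -> C (lie c x)) ->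
  nilpotent_mx x ->
  exists k', mxflag [set a *: x + c | a in setT & c in C] k' `<=` [set 0].
Proof.
move=> Ck Cx [m xm]; set D := image2 _ _ _.
exists (k * m)%N; apply: subset_trans Ck.
have down j t N : mxflag D N `<=` mxflag C j ->
  mxflag D (N + t) `<=` [set u *m x ^+ t + v | u in mxflag C j & v in mxflag C j.+1].
  move=> DN; elim: t => [|t IHt].
    rewrite addn0 => v /DN Cv; exists v => //; exists 0.
      by have [] := subspace_flag natrep C j.+1.
    by rewrite expr0 mulmx1 addr0.
  rewrite addnS; apply: lin_span_sub.
    have sj := subspace_flag natrep C j; have sj1 := subspace_flag natrep C j.+1.
    split; first exists 0; first by case: sj.
      by exists 0; [case: sj1|rewrite mul0mx addr0].
    move=> a _ _ [u1 Cu1 [v1 Cv1 <-]] [u2 Cu2 [v2 Cv2 <-]].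
    exists (a *: u1 + u2); first by case: sj => _; apply.
    exists (a *: v1 + v2); first by case: sj1 => _; apply.
    by rewrite mulmxDl -scalemxAl scalerDr addrACA.
  move=> _ [_ [_ [/IHt [u Cu [v Cv <-]] [a _ [c Cc <-]] ->]]].
  have Cux s : mxflag C j (u *m x ^+ s).
    elim: s => [|s IHs]; first by rewrite expr0 mulmx1.
    by rewrite exprSr -mulmxE mulmxA; apply: flag_normalizer IHs.
  exists (a *: u); first by apply: subspaceZ => //; apply: subspace_flag.
  exists (u *m x ^+ t *m c + v *m (a *: x + c)).
    apply: subspaceD; first exact: subspace_flag.
      exact: (flag_act (R := natrep)).
    rewrite [v *m _]mulmxDr; apply: subspaceD; first exact: subspace_flag.
      rewrite -scalemxAr; apply: subspaceZ; first exact: subspace_flag.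
      exact: flag_normalizer.
    by apply: flagS; apply: (flag_act (R := natrep)).
  rewrite natrepE mulmxDl [_ *m _ *m (_ + _)]mulmxDr addrA; congr (_ + _ + _).
  by rewrite -scalemxAr -scalemxAl -mulmxA mulmxE -exprSr.
elim: (k) => [//|j IHj]; rewrite mulSn addnC => v /(down _ _ _ IHj).
by move=> [u _ [w Cw <-]]; rewrite xm mulmx0 add0r.
Qed.

(** A subalgebra of H with nilpotent flag and of largest dimension is H itself:
    otherwise an element normalizing it could be adjoined. *)
Theorem engel H : subalgebra H -> (forall X, H X -> nilpotent_mx X) ->
  exists k, mxflag H k `<=` [set 0].
Proof.
move=> aH nH; have [sH lH] := aH.
pose P n := `[< exists U : {vspace 'M[F]_d},
  [/\ \dim U = n, [set x | x \in U] `<=` H, subalgebra [set x | x \in U]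
    & exists k, mxflag [set x | x \in U] k `<=` [set 0]] >].
have P0 : exists n, P n.
  exists 0; apply/asboolP; exists 0%VS; split.
  - exact: dimv0.
  - by move=> x /=; rewrite memv0 => /eqP ->; case: sH.
  - split; first by split=> [|c x y xU yU]; [apply: mem0v|apply: memvD (memvZ _ _) _].
    by move=> x y /=; rewrite !memv0 => /eqP -> /eqP ->; rewrite liexx.
  exists 1; apply: lin_span_sub subspace_set0 _ => _ [v [c [_ /= cU ->]]].
  by move: cU; rewrite memv0 => /eqP ->; apply: mulmx0.
have Pmax n : P n -> (n <= \dim {: 'M[F]_d})%N.
  by move/asboolP => [U [<- _ _ _]]; apply/dimvS/subvf.
case: (ex_maxnP P0 Pmax) => n /asboolP [U [dU UH [_ lU] [k Uk]]] nmax.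
exists k; suff -> : H = [set x | x \in U] by [].
apply/seteqP; split=> //; apply: contrapT => nHU.
have [x [Hx xU Ux]] := nil_normalizer_proper aH UH Uk nHU.
suff /nmax : P n.+1 by rewrite ltnn.
have memVE : [set y | y \in (<[x]> + U)%VS] =
             [set a *: x + c | a in setT & c in [set x | x \in U]].
  apply/seteqP; split=> y.
    by move=> /memv_addP [_ /vlineP [a ->] [c cU ->]]; exists a => //; exists c.
  by move=> [a _ [c cU <-]]; apply: memv_add => //; apply: memvZ (memv_line _).
have VH : [set y | y \in (<[x]> + U)%VS] `<=` H.
  rewrite memVE => _ [a _ [c cU <-]].
  by apply: subspaceD => //; [apply: subspaceZ|apply: UH].
apply/asboolP; exists (<[x]> + U)%VS; split=> //.
- have x0 : x != 0 by apply: contraNneq xU => ->; rewrite mem0v.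
  rewrite dimv_disjoint_sum ?dU ?dim_vline ?x0 //.
  apply/eqP; rewrite -subv0; apply/subvP => y; rewrite memv_cap => /andP[+ yU].
  move=> /vlineP [a ya]; rewrite memv0 ya.
  have [->|a0] := eqVneq a 0; first by rewrite scale0r.
  by case/negP: xU; rewrite -[x]scale1r -(mulVf a0) -scalerA -ya memvZ.
- split; first by split=> [|c u v uU vU]; [apply: mem0v|apply: memvD (memvZ _ _) _].
  rewrite memVE => _ _ [a _ [c cU <-]] [b _ [e eU <-]]; exists 0 => //.
  exists (lie (a *: x + c) (b *: x + e)); last by rewrite scale0r add0r.
  rewrite lie_linearl !lie_linearr liexx scaler0 add0r [lie c x]lieC.
  apply: memvD; first exact/memvZ/Ux.
  by apply: memvD (lU _ _ cU eU); rewrite memvZ // memvN Ux.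
rewrite memVE; apply: nil_flag_adjoin Uk _ (nH _ Hx) => c cU.
by rewrite /= lieC memvN Ux.
Qed.

End Engel.

(** * Rational relations between elements of a field of characteristic 0 *)
Section RationalRelations.
Context {K : fieldType}.
Hypothesis char0 : [pchar K] =i pred0.

Lemma intr_pchar0_eq0 (z : int) : (z%:~R == 0 :> K) = (z == 0).
Proof.
have nat0 n : (n%:R == 0 :> K) = (n == 0)%N by move/pcharf0P: char0.
by case: z => n; rewrite ?NegzE ?mulrNz ?oppr_eq0 -?pmulrn nat0.
Qed.

(** As [ratr q] can be computed from any fraction equal to q, [ratr] is a ring
    morphism into every field of characteristic 0, ordered or not. *)
Lemma ratr_pchar0P (q : rat) (m n : int) : n != 0 ->
  q * n%:~R = m%:~R -> ratr q = m%:~R / n%:~R :> K.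
Proof.
move=> n0 qnm; apply/eqP; rewrite /ratr eqr_div ?intr_pchar0_eq0 ?denq_neq0 //.
rewrite -!intrM; apply/eqP; congr (_%:~R); apply: (@intr_inj rat).
by rewrite !intrM -qnm numqE mulrAC.
Qed.

Lemma ratr_pchar0D (p q : rat) : ratr (p + q) = ratr p + ratr q :> K.
Proof.
have dK r : (denq r)%:~R != 0 :> K by rewrite intr_pchar0_eq0 denq_neq0.
rewrite (@ratr_pchar0P _ (numq p * denq q + numq q * denq p) (denq p * denq q)).
- by rewrite /ratr rmorphD !rmorphM /=; field; rewrite !dK.
- by rewrite mulf_neq0 ?denq_neq0.
by rewrite rmorphD !rmorphM /= !numqE; ring.
Qed.

Lemma ratr_pchar0M (p q : rat) : ratr (p * q) = ratr p * ratr q :> K.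
Proof.
have dK r : (denq r)%:~R != 0 :> K by rewrite intr_pchar0_eq0 denq_neq0.
rewrite (@ratr_pchar0P _ (numq p * numq q) (denq p * denq q)).
- by rewrite /ratr !rmorphM /=; field; rewrite !dK.
- by rewrite mulf_neq0 ?denq_neq0.
by rewrite !rmorphM /= !numqE; ring.
Qed.

Lemma ratr_pchar0B (p q : rat) : ratr (p - q) = ratr p - ratr q :> K.
Proof.
rewrite ratr_pchar0D; congr (_ + _); rewrite -mulN1r ratr_pchar0M.
by rewrite (ratr_int K (-1)) mulrN1z mulN1r.
Qed.

(** Let N be the space of rational relations u between the l i, and w
    orthogonal to N.  By hypothesis (m i * w i) is again in N, so it is
    orthogonal to w and the sum of the m i * (w i)^2 is 0; thus w = 0.  Hence N
    is the whole space and contains the relations l i = 0. *)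
Lemma rat_self_orthogonal_relations n (l : 'I_n -> K) (m : 'I_n -> nat) :
  (forall i, (0 < m i)%N) ->
  (forall w : 'I_n -> rat,
     (forall u : 'I_n -> rat, \sum_i ratr (u i) * l i = 0 -> \sum_i u i * w i = 0) ->
     \sum_i ratr (w i) * ((m i)%:R * l i) = 0) ->
  forall i, l i = 0.
Proof.
move=> m0 selforth i.
pose N := [set u : 'rV[rat]_n | \sum_i ratr (u 0 i) * l i = 0].
have sN : subspace N.
  split=> [|c u v Nu Nv]; rewrite /N /=.
    by apply: big1 => j _; rewrite mxE (ratr_int K 0) mul0r.
  transitivity (ratr c * (\sum_j ratr (u 0 j) * l j) + \sum_j ratr (v 0 j) * l j).
    rewrite mulr_sumr -big_split; apply: eq_bigr => j _.
    by rewrite !mxE ratr_pchar0D ratr_pchar0M mulrDl mulrA.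
  by rewrite Nu Nv mulr0 addr0.
have [U NU] := subspace_vspace sN.
pose G := \matrix_(j < \dim U) (vbasis U)`_j.
have GE (c : 'rV_(\dim U)) : c *m G = \sum_j c 0 j *: (vbasis U)`_j.
  by rewrite mulmx_sum_row; apply: eq_bigr => j _; rewrite rowK.
have fG : row_full G.
  rewrite /row_full -mxrank_tr; apply: inj_row_free => w wG.
  have orth (u : 'rV_n) : N u -> \sum_j u 0 j * w 0 j = 0.
    rewrite NU => uU; transitivity ((w *m u^T) 0 0).
      by rewrite mxE; apply: eq_bigr => j _; rewrite mxE mulrC.
    have -> : u = (\row_j coord (vbasis U) j u) *m G.
      by rewrite GE {1}(coord_vbasis uU); apply: eq_bigr => j _; rewrite mxE.
    by rewrite trmx_mul mulmxA wG mul0mx mxE.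
  pose mw := \row_j ((m j)%:R * w 0 j).
  have /orth : N mw.
    rewrite /N /= -[RHS](selforth (w 0)) => [|u uN].
      apply: eq_bigr => j _; rewrite mxE ratr_pchar0M ratr_nat; ring.
    rewrite -[RHS](orth (\row_j u j)); first by apply: eq_bigr => j _; rewrite mxE.
    by rewrite /N /=; under eq_bigr do rewrite mxE.
  move=> sq0; apply/rowP => j; rewrite [RHS]mxE; apply/eqP.
  have sq k : mw 0 k * w 0 k = (m k)%:R * w 0 k ^+ 2 by rewrite mxE; ring.
  have pos k : true -> 0 <= mw 0 k * w 0 k.
    by move=> _; rewrite sq mulr_ge0 ?ler0n ?sqr_ge0.
  have q0 : mw 0 j * w 0 j = 0 by apply: (psumr_eq0P pos sq0).
  by move/eqP: q0; rewrite sq mulf_eq0 sqrf_eq0 pnatr_eq0 eqn0Ngt m0 /=.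
have : N (delta_mx 0 i).
  have /submxP [c ->] := submx_full (delta_mx 0 i : 'rV_n) fG.
  rewrite NU GE; apply: memv_suml => j _; apply/memvZ/vbasis_mem/mem_nth.
  by rewrite size_tuple.
rewrite /N /= (bigD1 i) //= mxE !eqxx (ratr_nat K 1) mul1r big1 ?addr0 //.
by move=> j ji; rewrite mxE (negPf ji) andbF (ratr_nat K 0) mul0r.
Qed.
End RationalRelations.

(** * Polynomials in a linear transformation *)
Section ChineseRemainder.
Context {K : fieldType}.

Lemma coprimep_exp_XsubC (a b : K) m n :
  a != b -> coprimep (('X - a%:P) ^+ m) (('X - b%:P) ^+ n).
Proof.
move=> ab; apply/coprimep_expl/coprimep_expr/coprimep_XsubC2.
by rewrite subr_eq0 eq_sym.
Qed.

Lemma coprimep_prod_exp_XsubC (t : seq K) (a : K) (k : K -> nat) n :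
  a \notin t -> coprimep (\prod_(b <- t) ('X - b%:P) ^+ k b) (('X - a%:P) ^+ n).
Proof.
elim: t => [|b t IHt]; first by rewrite big_nil coprime1p.
rewrite inE negb_or big_cons coprimepMl eq_sym => /andP [ba /IHt ->].
by rewrite coprimep_exp_XsubC.
Qed.

Lemma dvdp_prod_exp_XsubC (t : seq K) (k : K -> nat) (p : {poly K}) : uniq t ->
  (forall a, a \in t -> ('X - a%:P) ^+ k a %| p) ->
  \prod_(a <- t) ('X - a%:P) ^+ k a %| p.
Proof.
elim: t => [|a t IHt] /=; first by rewrite big_nil dvd1p.
move=> /andP [at_ ut] tp; rewrite big_cons Gauss_dvdp; last first.
  by rewrite coprimep_sym coprimep_prod_exp_XsubC.
by rewrite tp ?mem_head // IHt // => b bt; rewrite tp // inE bt orbT.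
Qed.

(** Chinese remaindering modulo the pairwise coprime (X - a)^k. *)
Lemma poly_interpolation (t : seq K) (g : K -> K) k : uniq t ->
  exists p : {poly K}, forall a, a \in t -> ('X - a%:P) ^+ k %| p - (g a)%:P.
Proof.
elim: t => [|a t IHt] /=; first by exists 0.
move=> /andP [at_ /IHt [p pt]].
have := coprimep_prod_exp_XsubC (fun=> k) k at_.
set Q := \prod_(b <- t) _; move=> /Bezout_eq1_coprimepP [[u v] /= uv].
exists (p + ((g a)%:P - p) * (u * Q)) => b; rewrite inE => /predU1P [->|bt].
  have -> : p + ((g a)%:P - p) * (u * Q) - (g a)%:P =
            (p - (g a)%:P) * v * ('X - a%:P) ^+ k.
    by rewrite -[u * Q](addrK (v * ('X - a%:P) ^+ k)) uv; ring.
  exact: dvdp_mull.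
rewrite addrAC dvdp_add ?pt // !dvdp_mull // /Q (big_rem b) //=.
exact: dvdp_mulr.
Qed.

End ChineseRemainder.

Section PolynomialAction.
Context {K : fieldType} {V : lmodType K}.
Variable T : {linear V -> V}.
Implicit Types (p q : {poly K}) (v w : V).

(** p(T) v by Horner's scheme, in a module V of any dimension. *)
Definition poly_act p v : V := foldr (fun c w => c *: v + T w) 0 p.

Lemma poly_act0 v : poly_act 0 v = 0.
Proof. by rewrite /poly_act polyseq0. Qed.

Lemma poly_act_cons p c v : poly_act (p * 'X + c%:P) v = c *: v + T (poly_act p v).
Proof.
rewrite -cons_poly_def /poly_act polyseq_cons.
case: nilP => [->|//]; rewrite polyseqC /= linear0 addr0.
by case: eqP => [->|]; rewrite /= ?scale0r ?linear0 ?addr0.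
Qed.

Lemma poly_actC c v : poly_act c%:P v = c *: v.
Proof.
by rewrite -[c%:P]add0r -[0](mul0r 'X) poly_act_cons poly_act0 linear0 addr0.
Qed.

Lemma poly_act_linear p c v w :
  poly_act p (c *: v + w) = c *: poly_act p v + poly_act p w.
Proof.
elim/poly_ind: p => [|p a IHp]; first by rewrite !poly_act0 scaler0 addr0.
by rewrite !poly_act_cons IHp linearP !scalerDr !scalerA [c * a]mulrC addrACA.
Qed.

Lemma poly_actr0 p : poly_act p 0 = 0.
Proof.
by have := poly_act_linear p (-1) 0 0; rewrite scaler0 addr0 scaleN1r addNr.
Qed.

Lemma poly_act_sum p (I : finType) (f : I -> V) :
  poly_act p (\sum_i f i) = \sum_i poly_act p (f i).
Proof.
apply: (big_morph (poly_act p)) => [v w|]; last exact: poly_actr0.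
by rewrite -[v]scale1r poly_act_linear !scale1r.
Qed.

Lemma poly_actD p q v : poly_act (p + q) v = poly_act p v + poly_act q v.
Proof.
elim/poly_ind: p q => [|p a IHp] q; first by rewrite poly_act0 !add0r.
elim/poly_ind: q => [|q b _]; first by rewrite poly_act0 !addr0.
by rewrite addrACA -mulrDl -rmorphD !poly_act_cons IHp linearD scalerDl addrACA.
Qed.

Lemma poly_actM p q v : poly_act (p * q) v = poly_act p (poly_act q v).
Proof.
elim/poly_ind: p => [|p a IHp]; first by rewrite mul0r !poly_act0.
rewrite mulrDl poly_actD poly_act_cons -IHp -mulrA ['X * q]mulrC mulrA.
rewrite -[p * q * 'X]addr0 poly_act_cons scale0r add0r addrC; congr (_ + _).
elim/poly_ind: q {IHp} => [|q b IHq]; first by rewrite mulr0 poly_act0 scaler0.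
rewrite mulrDr mulrA -polyCM !poly_act_cons IHq scalerDr scalerA.
by rewrite linearZ.
Qed.

Lemma poly_act_XsubC a v : poly_act ('X - a%:P) v = T v - a *: v.
Proof.
have -> : 'X - a%:P = 1%:P * 'X + (- a)%:P by rewrite mul1r polyCN.
by rewrite poly_act_cons poly_actC scale1r scaleNr addrC.
Qed.

Lemma poly_act_subspace (U : set V) p v : subspace U ->
  (forall w, U w -> U (T w)) -> U v -> U (poly_act p v).
Proof.
move=> sU TU Uv; elim/poly_ind: p => [|p c IHp].
  by rewrite poly_act0; case: sU.
by rewrite poly_act_cons; apply: (proj2 sU) => //; apply: TU.
Qed.

(** Interpolating g at the mu i modulo high powers gives a polynomial p with
    p(T) (v i) = g (mu i) v i, and p(T) preserves U. *)
Lemma generalized_eigen_replica (I : finType) (U : set V) (mu : I -> K) (v : I -> V)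
    k (g : K -> K) :
  subspace U -> (forall w, U w -> U (T w)) ->
  (forall i, iter k (fun w => T w - mu i *: w) (v i) = 0) ->
  U (\sum_i v i) -> U (\sum_i g (mu i) *: v i).
Proof.
move=> sU TU v0 Uv.
have [p pP] := poly_interpolation g k (undup_uniq (codom mu)).
suff -> : \sum_i g (mu i) *: v i = poly_act p (\sum_i v i).
  exact: poly_act_subspace.
rewrite poly_act_sum; apply: eq_bigr => i _.
have /pP/dvdpP [q pE] : mu i \in undup (codom mu) by rewrite mem_undup codom_f.
rewrite -(subrK (g (mu i))%:P p) pE poly_actD poly_actC poly_actM.
suff -> : poly_act (('X - (mu i)%:P) ^+ k) (v i) = 0.
  by rewrite poly_actr0 add0r.
rewrite -(v0 i); elim: k {v0 pP pE} => [|k IHk]; first by rewrite expr0 poly_actC scale1r.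
by rewrite exprS poly_actM IHk poly_act_XsubC iterS.
Qed.

End PolynomialAction.

(** * Spectral projections of a matrix with split characteristic polynomial *)
Section SplitCartan.
Context {K : fieldType}.

(** On m the operator ad x - (b - a) is the difference of the right
    multiplication by x - b and the left multiplication by x - a, which
    commute. *)
Lemma iter_ad_generalized_eigen d (x m : 'M[K]_d) (a b : K) i j :
  (x - a%:M) ^+ i *m m = 0 -> m *m (x - b%:M) ^+ j = 0 ->
  iter (i + j) (fun w => ad x w - (b - a) *: w) m = 0.
Proof.
set f := (fun w : 'M[K]_d => _).
have fE w : f w = w *m (x - b%:M) - (x - a%:M) *m w.
  rewrite /f /ad mxlieE mulmxBr mulmxBl mul_mx_scalar mul_scalar_mx scalerBl.
  by rewrite !opprB addrACA [RHS]addrACA; congr (_ + _); rewrite addrC.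
have fB n u v : iter n f (u - v) = iter n f u - iter n f v.
  elim: n => [//|n IHn]; rewrite !iterS IHn !fE [LHS]/=.
  rewrite [(_ - _) *m (x - _)]mulmxBl [(x - _) *m (_ - _)]mulmxBr.
  by rewrite !opprB addrACA [RHS]addrACA; congr (_ + _); rewrite addrC.
have f0 n : iter n f 0 = 0 by rewrite -[X in iter n f X](subrr (0 : 'M_d)) fB subrr.
move En : (i + j)%N => n; elim: n => [|n IHn] in i j m En *.
  by move: En => /eqP; rewrite addn_eq0 => /andP [/eqP -> _]; rewrite expr0 mul1mx.
case: i => [|i] in En *; first by rewrite expr0 mul1mx => -> _.
case: j => [|j] in En *; first by rewrite expr0 mulmx1 => _ ->.
move=> im jm; rewrite iterSr fE fB (IHn i.+1 j) ?(IHn i j.+1) ?subr0 //.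
- by move: En; rewrite addSn => -[].
- by rewrite mulmxA -[X in X *m m]exprSr.
- by rewrite -mulmxA jm mulmx0.
- by move: En; rewrite addnS => -[].
- by rewrite mulmxA im mul0mx.
- by rewrite -mulmxA -[X in m *m X]exprS.
Qed.

Lemma eigenvector_horner_mx d (x : 'M[K]_d.+1) (v : 'rV_d.+1) a p :
  v *m x = a *: v -> v *m horner_mx x p = p.[a] *: v.
Proof.
move=> vx; elim/poly_ind: p => [|p c IHp].
  by rewrite rmorph0 mulmx0 horner0 scale0r.
rewrite rmorphD rmorphM /= horner_mx_X horner_mx_C mulmxDr mulmxA IHp.
by rewrite -scalemxAl vx mul_mx_scalar scalerA -scalerDl !hornerE.
Qed.

Section SpectralProjections.
Variables (d : nat) (x : 'M[K]_d.+1) (s : seq K).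
Hypothesis charx : char_poly x = \prod_(a <- s) ('X - a%:P).

Let t := undup s.
Let eig (i : 'I_(size t)) := t`_i.

Lemma horner_mx_eq0_of_dvdp p :
  (forall i, ('X - (eig i)%:P) ^+ d.+1 %| p) -> horner_mx x p = 0.
Proof.
move=> pP; suff /dvdpP [q ->] : char_poly x %| p.
  by rewrite rmorphM /= Cayley_Hamilton mulr0.
rewrite charx -prodr_undup_exp_count.
have size_s : size s = d.+1.
  by have := size_char_poly x; rewrite charx size_prod_XsubC => -[].
apply: (dvdp_prod_exp_XsubC (k := fun a => count_mem a s) (undup_uniq s)) => a a_t.
have ai : (index a t < size t)%N by rewrite index_mem.
have := pP (Ordinal ai); rewrite /eig /= nth_index //; apply: dvdp_trans.
by apply: dvdp_exp2l; rewrite -size_s count_size.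
Qed.

(** The matrix p i (x) is then the projection onto the generalized eigenspace
    of eig i along the other ones; the exponent d + 1, the size of x, bounds
    all multiplicities in the characteristic polynomial. *)
Definition spectral_poly (p : 'I_(size t) -> {poly K}) :=
  forall i j, ('X - (eig j)%:P) ^+ d.+1 %| p i - (i == j)%:R%:P.

Lemma exists_spectral_poly : exists p, spectral_poly p.
Proof.
have /choice [p pP] : forall i : 'I_(size t), exists p : {poly K},
    forall j, ('X - (eig j)%:P) ^+ d.+1 %| p - (i == j)%:R%:P.
  move=> i.
  have [p pP] := poly_interpolation (fun a => (eig i == a)%:R) d.+1 (undup_uniq s).
  exists p => j; have := pP (eig j) (mem_nth 0 (ltn_ord j)).
  by rewrite /eig nth_uniq ?undup_uniq.
by exists p => i j.
Qed.

Variable p : 'I_(size t) -> {poly K}.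
Hypothesis pP : spectral_poly p.
Let E i := horner_mx x (p i).

Let killP i j q : ('X - (eig j)%:P) ^+ d.+1 %| p i - (i == j)%:R%:P ->
  i != j -> ('X - (eig j)%:P) ^+ d.+1 %| q * p i.
Proof. by move=> + /negPf ij; rewrite ij subr0 => ?; apply: dvdp_mull. Qed.

Lemma spectral_sum1 : \sum_i E i = 1%:M.
Proof.
apply/eqP; rewrite -subr_eq0 -[1%:M](rmorph1 (horner_mx x)) -raddf_sum -rmorphB /=.
apply/eqP/horner_mx_eq0_of_dvdp => j; rewrite (bigD1 j) //= addrAC.
apply: dvdp_add; first by have := pP j j; rewrite eqxx.
apply: (big_ind (dvdp _)) => [|u v|i ij]; [exact: dvdp0|exact: dvdp_add|].
by rewrite -[p i]mul1r; apply: killP.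
Qed.

Lemma spectral_idempotent i : E i *m E i = E i.
Proof.
apply/eqP; rewrite -subr_eq0 mulmxE -rmorphM -rmorphB.
apply/eqP/horner_mx_eq0_of_dvdp => j.
have -> : p i * p i - p i = (p i - 1) * p i by rewrite mulrBl mul1r.
have [<-|ij] := eqVneq i j; last exact: killP.
by apply: dvdp_mulr; have := pP i i; rewrite eqxx.
Qed.

Lemma spectral_nilpotent i : (x - (eig i)%:M) ^+ d.+1 *m E i = 0.
Proof.
have -> : x - (eig i)%:M = horner_mx x ('X - (eig i)%:P).
  by rewrite rmorphB /= horner_mx_X horner_mx_C.
rewrite mulmxE -rmorphXn -rmorphM; apply: horner_mx_eq0_of_dvdp => j.
by have [<-|ij] := eqVneq i j; [apply: dvdp_mulr|apply: killP].
Qed.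

Lemma spectral_comm i : E i *m x = x *m E i.
Proof. exact: (esym (comm_mx_horner (p i) (comm_mx_refl x))). Qed.

Lemma spectral_neq0 i : E i != 0.
Proof.
have : eigenvalue x (eig i).
  rewrite eigenvalue_root_char charx root_prod_XsubC -mem_undup.
  exact: mem_nth.
case/eigenvalueP => v vx v0; apply: contra_neq v0 => E0.
have := eigenvector_horner_mx (p i) vx; rewrite -/(E i) E0 mulmx0.
have /dvdpP [q /(congr1 (horner^~ (eig i)))] := pP i i.
rewrite eqxx /= hornerM horner_exp hornerXsubC subrr expr0n mulr0 hornerD hornerN hornerC.
by move=> /eqP; rewrite subr_eq0 => /eqP ->; rewrite scale1r.
Qed.

(** x E i differs from eig i times E i by a nilpotent matrix. *)
Lemma spectral_mxtrace i : \tr (x *m E i) = (\rank (E i))%:R * eig i.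
Proof.
rewrite -(idempotent_mxtrace (spectral_idempotent i)) mulrC -mxtraceZ.
apply/eqP; rewrite -subr_eq0 -raddfB /= -mul_scalar_mx -mulmxBl.
apply/eqP/nilpotent_mxtrace; exists d.+1.
rewrite mulmxE exprMn_comm; last first.
  rewrite /GRing.comm -!mulmxE mulmxBl mulmxBr spectral_comm.
  by rewrite mul_scalar_mx mul_mx_scalar.
by rewrite [E i ^+ _]exprS mulrA -[X in X * _]/(_ *m _) spectral_nilpotent mul0r.
Qed.

End SpectralProjections.
End SplitCartan.

(** * Cartan's criterion *)
Lemma derived_sub (F : fieldType) (L : lieAlgType F) (A B : set L) :
  A `<=` B -> derived A `<=` derived B.
Proof.
move=> AB; apply: lin_span_mono => _ [x [y [Ax Ay ->]]].
by exists x, y; split; auto.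
Qed.

Lemma derived_subalgebra (F : fieldType) (L : lieAlgType F) (A : set L) :
  subalgebra A -> derived A `<=` A.
Proof.
by move=> [sA lA]; apply: lin_span_sub => // _ [x [y [Ax Ay ->]]]; apply: lA.
Qed.

Lemma subalgebra_derived (F : fieldType) (L : lieAlgType F) (A : set L) :
  subalgebra A -> subalgebra (derived A).
Proof.
move=> aA; split=> [|x y Dx Dy]; first exact: subspace_lin_span.
by apply: sub_lin_span; exists x, y; split=> //; apply: derived_subalgebra.
Qed.

Lemma mxtrace_lie (F : fieldType) d (a b y : 'M[F]_d) :
  \tr (lie a b *m y) = \tr (a *m lie b y).
Proof.
rewrite !mxlieE mulmxBl mulmxBr !raddfB /= !mulmxA; congr (_ - _).
by rewrite -[b *m a *m y]mulmxA [LHS]mxtrace_mulC.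
Qed.

Section CartanSplit.
Context {K : fieldType}.
Hypothesis char0 : [pchar K] =i pred0.

(** For x = [a, b], invariance turns tr(x y) into tr(a [b, y]); only [b, y],
    and not y itself, has to lie in S. *)
Lemma mxtrace_derived_eq0 d (S : set 'M[K]_d) (x y : 'M[K]_d) :
  (forall a b, S a -> S b -> \tr (a *m b) = 0) ->
  (forall b, S b -> S (lie b y)) -> derived S x -> \tr (x *m y) = 0.
Proof.
move=> trS Sy Dx; apply: (lin_span_sub (subspace_mxtrace_mull y) _ Dx).
by move=> _ [a [b [Sa Sb ->]]]; rewrite /= mxtrace_lie trS //; apply: Sy.
Qed.

(** Let the distinct eigenvalues of x be the l i, with projections E i.  A
    rational vector w orthogonal to all rational relations between the l i
    defines y, the sum of the w i E i.  On the component E i b E j of b, which is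
    generalized eigen for ad x with eigenvalue l j - l i, ad y is the scalar
    w j - w i, and this depends only on l j - l i by the choice of w.
    So [b, y] is in S, hence tr(x y) = 0, and this trace is the sum of the
    (w i) (rank E i) (l i): [rat_self_orthogonal_relations] applies. *)
Lemma nilpotent_derived_split d (S : set 'M[K]_d.+1) (x : 'M[K]_d.+1) s :
  subalgebra S -> (forall a b, S a -> S b -> \tr (a *m b) = 0) ->
  derived S x -> char_poly x = \prod_(a <- s) ('X - a%:P) -> nilpotent_mx x.
Proof.
move=> aS trS Dx charx; have [sS lS] := aS.
have Sx : S x by apply: derived_subalgebra Dx.
have [p pP] := exists_spectral_poly d s.
set t := undup s in p pP; pose l (i : 'I_(size t)) := t`_i.
pose E i := horner_mx x (p i).
have E1 : \sum_i E i = 1%:M := spectral_sum1 charx pP.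
suff l0 i : l i = 0.
  exists (size s); have := Cayley_Hamilton x; rewrite charx.
  rewrite (eq_big_seq (fun=> 'X)) => [|a a_s]; last first.
    have at_ : (index a t < size t)%N by rewrite index_mem mem_undup.
    have := l0 (Ordinal at_); rewrite /l /= nth_index ?mem_undup // => ->.
    by rewrite subr0.
  by rewrite big_const_seq count_predT -Monoid.iteropE rmorphXn /= horner_mx_X.
apply: (@rat_self_orthogonal_relations _ char0 _ l (fun i => \rank (E i))).
  by move=> j; rewrite lt0n mxrank_eq0 spectral_neq0.
move=> w orth.
pose W i : K := ratr (w i); pose y := \sum_i W i *: E i.
have <- : \tr (x *m y) = \sum_j W j * ((\rank (E j))%:R * l j).
  rewrite mulmx_sumr raddf_sum; apply: eq_bigr => j _.
  by rewrite -scalemxAr /= mxtraceZ (spectral_mxtrace charx pP).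
apply: mxtrace_derived_eq0 trS _ Dx => b Sb.
pose I := ('I_(size t) * 'I_(size t))%type.
pose mu (q : I) := l q.2 - l q.1; pose nu (q : I) := W q.2 - W q.1.
have mu_nu q r : mu q = mu r -> nu q = nu r.
  move=> qr; apply/eqP; rewrite -subr_eq0 /nu /W -!ratr_pchar0B //.
  (* u is the relation expressing mu q = mu r between the eigenvalues; its
     coefficients account for coincidences among the four indices. *)
  pose u j : rat := ((j == q.2)%:R - (j == q.1)%:R) - ((j == r.2)%:R - (j == r.1)%:R).
  have sumE (R : comNzRingType) (f : 'I_(size t) -> R) (h : rat -> R) :
      h 0 = 0 -> h 1 = 1 -> {morph h : a c / a - c} ->
      \sum_j h (u j) * f j = (f q.2 - f q.1) - (f r.2 - f r.1).
    move=> h0 h1 hB.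
    have pick k : \sum_j h (j == k)%:R * f j = f k.
      rewrite (bigD1 k) //= eqxx h1 mul1r big1 ?addr0 // => j /negPf ->.
      by rewrite h0 mul0r.
    by rewrite -!pick -!sumrB; apply: eq_bigr => j _; rewrite !hB; ring.
  have : \sum_j u j * w j = 0.
    apply: orth; rewrite (sumE _ l ratr) ?(ratr_int K 0) ?(ratr_int K 1) //.
      by rewrite -/(mu q) -/(mu r) qr subrr.
    exact: ratr_pchar0B.
  by rewrite (sumE _ w id) // => ->; rewrite (ratr_int K 0).
pose g a := if [pick q | mu q == a] is Some q then nu q else 0.
have gmu q : g (mu q) = nu q.
  rewrite /g; case: pickP => [r /eqP /mu_nu //|/(_ q)].
  by rewrite eqxx.
pose v (q : I) := E q.1 *m b *m E q.2.
have bE : b = \sum_(q : I) v q.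
  rewrite -[LHS]mul1mx -[LHS]mulmx1 -E1 !mulmx_suml.
  rewrite -(pair_bigA _ (fun i1 j => v (i1, j))); apply: eq_bigr => i1 _.
  by rewrite mulmx_sumr.
have -> : lie b y = \sum_(q : I) g (mu q) *: v q.
  under eq_bigr do rewrite gmu.
  rewrite -(pair_bigA _ (fun i1 j => nu (i1, j) *: v (i1, j))) mxlieE.
  have -> : b *m y = \sum_i \sum_j W j *: v (i, j).
    rewrite -[b]mul1mx -E1 !mulmx_suml; apply: eq_bigr => i1 _.
    by rewrite mulmx_sumr; apply: eq_bigr => j _; rewrite -scalemxAr.
  have -> : y *m b = \sum_i \sum_j W i *: v (i, j).
    rewrite -[y *m b]mulmx1 -E1 !mulmx_suml; apply: eq_bigr => i1 _.
    rewrite -!scalemxAl mulmx_sumr scaler_sumr.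
    by apply: eq_bigr => j _.
  rewrite -sumrB; apply: eq_bigr => i1 _; rewrite -sumrB; apply: eq_bigr => j _.
  by rewrite -scalerBl.
apply: (generalized_eigen_replica (T := ad x) (mu := mu)
  (k := (d.+1 + d.+1)%N)) sS _ _ _ => [z Sz|q|].
- exact: lS.
- apply: iter_ad_generalized_eigen; rewrite /v.
    by rewrite !mulmxA (spectral_nilpotent charx pP) !mul0mx.
  have comm i1 : E i1 *m (x - (l i1)%:M) ^+ d.+1 = 0.
    rewrite -(spectral_nilpotent charx pP i1) !mulmxE.
    apply: commrX; apply: commrB; first exact: spectral_comm.
    by rewrite /GRing.comm -!mulmxE mul_scalar_mx mul_mx_scalar.
  by rewrite /= -[_ *m E q.2 *m _]mulmxA comm mulmx0.
- by rewrite -bE.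
Qed.

End CartanSplit.

Lemma exists_irreducible_dvdp (F : fieldType) (p : {poly F}) :
  (1 < size p)%N -> exists2 q, irreducible_poly q & q %| p.
Proof.
move=> p1.
pose P n := `[< exists q : {poly F}, [/\ size q = n, (1 < n)%N & q %| p] >].
have P0 : exists n, P n by exists (size p); apply/asboolP; exists p.
case: (ex_minnP P0) => _ /asboolP [q [<- q1 qp]] qmin; exists q => //.
split=> // r r1 rq; rewrite -dvdp_size_eqp // eqn_leq dvdp_leq //=; last first.
  by rewrite -size_poly_gt0 ltnW.
apply: qmin; apply/asboolP; exists r; split=> //; last exact: dvdp_trans qp.
have r0 : r != 0.
  by apply: contraTneq rq => ->; rewrite dvd0p -size_poly_gt0 ltnW.
by rewrite ltn_neqAle eq_sym r1 size_poly_gt0.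
Qed.

(** Roots are adjoined one at a time, the field changing at each step. *)
Lemma exists_splitting_field (F : fieldType) (p : {poly F}) : p \is monic ->
  exists (K : fieldType) (iota : {rmorphism F -> K}) (s : seq K),
    map_poly iota p = \prod_(a <- s) ('X - a%:P).
Proof.
move En : (size p) => n; elim: n => [|n IHn] in F p En *.
  by move/eqP: En; rewrite size_poly_eq0 => /eqP -> /monic_neq0; rewrite eqxx.
have [p1 mp|p1 mp] := leqP (size p) 1.
  exists F, idfun, [::]; rewrite big_nil map_poly_id //.
  by move: mp; rewrite monicE (size1_polyC p1) lead_coefC => /eqP ->.
have [q /irredp_FAdjoin [E _ [z qz _]] qp] := exists_irreducible_dvdp p1.
pose i : {rmorphism F -> E} := in_alg E.
have /factor_theorem [r rE] : root (map_poly i p) z.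
  by move: qp => /dvdpP [r ->]; rewrite rmorphM /= rootM qz orbT.
have mr : r \is monic.
  by have := mp; rewrite -(map_monic i) rE monicMr // monicXsubC.
have sr : size r = n.
  have := size_map_poly i p; rewrite rE size_Mmonic ?monic_neq0 ?monicXsubC //.
  by rewrite size_XsubC addn2 En => -[].
have [K [j [s rs]]] := IHn E r sr mr.
exists K, (j \o i), (rcons s (j z)).
rewrite map_poly_comp rE rmorphM /= rs -cats1 big_cat big_seq1 /=.
by rewrite rmorphB /= map_polyX map_polyC.
Qed.

Section CartanCriterion.
Context {F : fieldType}.
Hypothesis char0 : [pchar F] =i pred0.

(** The hypotheses are bilinear, so they pass to the span of S over a field
    containing the eigenvalues of x, and nilpotency of x descends. *)
Lemma nilpotent_derived_of_mxtrace d (S : set 'M[F]_d) (x : 'M[F]_d) :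
  subalgebra S -> (forall a b, S a -> S b -> \tr (a *m b) = 0) ->
  derived S x -> nilpotent_mx x.
Proof.
case: d => [|d] in S x *; first by move=> *; exists 0; apply/matrixP; case.
move=> [sS lS] trS Dx.
have [K [j [s charx]]] := exists_splitting_field (char_poly_monic x).
pose jS : set 'M[K]_d.+1 := [set map_mx j a | a in S].
have span2 (P : 'M[K]_d.+1 -> 'M[K]_d.+1 -> Prop) :
    (forall v, subspace [set u | P u v]) -> (forall u, subspace [set v | P u v]) ->
    (forall a b, S a -> S b -> P (map_mx j a) (map_mx j b)) ->
    forall u v, lin_span jS u -> lin_span jS v -> P u v.
  move=> sl sr PS u v Su Sv.
  suff /(_ u Su) : lin_span jS `<=` [set u | P u v] by [].
  apply: lin_span_sub => // _ [a Sa <-].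
  suff /(_ v Sv) : lin_span jS `<=` [set v | P (map_mx j a) v] by [].
  by apply: lin_span_sub => // _ [b Sb <-]; apply: PS.
have sP := @subspace_lin_span _ _ jS.
have map_lie a b : map_mx j (lie a b) = lie (map_mx j a) (map_mx j b).
  by rewrite !mxlieE map_mxB !map_mxM.
have aP : subalgebra (lin_span jS).
  split=> //; apply: (span2 (fun u v => lin_span jS (lie u v))).
  - move=> v; exact: (subspace_preimage (ad v) sP).
  - move=> u; have [P0 lP] := sP; split=> [|c a b Pa Pb]; rewrite /=.
      by rewrite mxlieE mul0mx mulmx0 subrr.
    by rewrite lie_linearr; apply: lP.
  - by move=> a b Sa Sb; apply: sub_lin_span; exists (lie a b); rewrite ?map_lie; auto.
have trP : forall a b, lin_span jS a -> lin_span jS b -> \tr (a *m b) = 0.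
  apply: (span2 (fun u v => \tr (u *m v) = 0)).
  - exact: subspace_mxtrace_mull.
  - by move=> u; under eq_set do rewrite mxtrace_mulC; apply: subspace_mxtrace_mull.
  - by move=> a b Sa Sb; rewrite -map_mxM trace_map_mx trS ?rmorph0.
have Dj : derived (lin_span jS) (map_mx j x).
  case: Dx => n [c [e [De ->]]].
  have -> : map_mx j (\sum_i c i *: e i) = \sum_i j (c i) *: map_mx j (e i).
    by rewrite raddf_sum; apply: eq_bigr => i _; rewrite /= map_mxZ.
  apply: subspace_sum (subspace_lin_span _) _ => i _.
  apply: subspaceZ (subspace_lin_span _) _; have [a [b [Sa Sb ->]]] := De i.
  apply: sub_lin_span; exists (map_mx j a), (map_mx j b); split=> //.
  - by apply: sub_lin_span; exists a.
  - by apply: sub_lin_span; exists b.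
  - exact: map_lie.
have char0K : [pchar K] =i pred0 by move=> q; rewrite (fmorph_pchar j) char0.
have [|k xk] := nilpotent_derived_split char0K aP trP Dj (s := s).
  by rewrite -map_char_poly charx.
by exists k; apply/eqP; rewrite -(map_mx_eq0 j) rmorphXn /= xk.
Qed.

(** The derived algebra consists of nilpotent matrices, so it is
    solvable by Engel's theorem. *)
Theorem cartan_criterion d (S : set 'M[F]_d) : subalgebra S ->
  (forall a b, S a -> S b -> \tr (a *m b) = 0) -> solvable S.
Proof.
move=> aS trS.
have [k Dk] := engel (subalgebra_derived aS)
  (fun x => nilpotent_derived_of_mxtrace aS trS (x := x)).
have [m Dm] := nil_flag_solvable natrep_faithful Dk.
by exists m.+1; rewrite iterSr.
Qed.

End CartanCriterion.

(** * Solvable ideals and the radical of the enveloping algebra *)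
Section EnvelopingAlgebra.
Context {F : fieldType} {d : nat}.
Hypothesis char0 : [pchar F] =i pred0.
Variable S : set 'M[F]_d.

Inductive enveloping : 'M[F]_d -> Prop :=
| enveloping_gen s : S s -> enveloping s
| enveloping1 : enveloping 1
| enveloping_lin c u v : enveloping u -> enveloping v -> enveloping (c *: u + v)
| enveloping_mul u v : enveloping u -> enveloping v -> enveloping (u *m v).

(** In characteristic 0 this is the Jacobson radical of the associative algebra
    generated by S. *)
Definition trace_radical : set 'M[F]_d :=
  [set c | enveloping c /\ forall u, enveloping u -> \tr (c *m u) = 0].

Local Notation N := trace_radical.

Lemma enveloping_exp u k : enveloping u -> enveloping (u ^+ k).
Proof.
move=> Eu; elim: k => [|k IHk]; first exact: enveloping1.
by rewrite exprS; apply: enveloping_mul.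
Qed.

Lemma subspace_enveloping : subspace enveloping.
Proof.
split; last exact: enveloping_lin.
have := enveloping_lin (-1) enveloping1 enveloping1.
by rewrite scaleN1r addNr.
Qed.

Lemma subspace_trace_radical : subspace N.
Proof.
have [E0 lE] := subspace_enveloping.
split=> [|c a b [Ea a0] [Eb b0]].
  by split=> // u _; rewrite mul0mx mxtrace0.
split=> [|u Eu]; first exact: lE.
by rewrite mulmxDl -scalemxAl linearD linearZ /= a0 // b0 // mulr0 addr0.
Qed.

Lemma trace_radical_mulr n u : N n -> enveloping u -> N (n *m u).
Proof.
move=> [En n0] Eu; split=> [|v Ev]; first exact: enveloping_mul.
by rewrite -mulmxA n0 //; apply: enveloping_mul.
Qed.

Lemma trace_radical_mull n u : N n -> enveloping u -> N (u *m n).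
Proof.
move=> [En n0] Eu; split=> [|v Ev]; first exact: enveloping_mul.
by rewrite -mulmxA mxtrace_mulC -mulmxA n0 //; apply: enveloping_mul.
Qed.

Lemma trace_radical_lie n u : N n -> enveloping u -> N (lie n u).
Proof.
move=> Nn Eu; rewrite mxlieE; apply: subspaceB subspace_trace_radical _ _.
  exact: trace_radical_mulr.
exact: trace_radical_mull.
Qed.

Lemma trace_radical_nilpotent n : N n -> nilpotent_mx n.
Proof.
move=> [En n0]; apply: nilpotent_mxtrace_expr => // k.
by rewrite exprS n0 //; apply: enveloping_exp.
Qed.

(** An element commuting with c modulo the radical commutes with the powers
    of c. *)
Lemma trace_radical_lie_exp c z k :
  enveloping c -> enveloping z -> N (lie c z) -> N (lie (c ^+ k) z).
Proof.
move=> Ec Ez Ncz; elim: k => [|k IHk].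
  rewrite mxlieE mulmx1 mul1mx subrr.
  by have [] := subspace_trace_radical.
have -> : lie (c ^+ k.+1) z = c ^+ k *m lie c z + lie (c ^+ k) z *m c.
  rewrite !mxlieE mulmxBr mulmxBl !mulmxA exprSr -mulmxE.
  by rewrite -[c ^+ k *m z *m c]mulmxA addrA subrK mulmxA.
apply: subspaceD subspace_trace_radical _ _.
  by apply: trace_radical_mull => //; apply: enveloping_exp.
exact: trace_radical_mulr.
Qed.

(** C + N is a Lie algebra of nilpotent matrices, so its flag V_i is finite by
    Engel's theorem.  It is normalized by S, hence stable under the enveloping
    algebra: c u maps V_i into V_(i+1) for c in C, and has trace 0. *)
Lemma nil_ideal_sub_trace_radical (C : set 'M[F]_d) :
  subspace C -> C `<=` S ->
  (forall c s, C c -> S s -> C (lie c s)) ->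
  (forall c e, C c -> C e -> N (lie c e)) ->
  (forall c, C c -> nilpotent_mx c) -> C `<=` N.
Proof.
move=> sC CS idC abC nilC; have sN := subspace_trace_radical.
have CE c : C c -> enveloping c by move/CS; apply: enveloping_gen.
pose H : set 'M[F]_d := [set c + n | c in C & n in N].
have aH : subalgebra H.
  split; first split.
  - by exists 0; [case: sC|exists 0; [case: sN|rewrite addr0]].
  - move=> a _ _ [c Cc [n Nn <-]] [e Ce [m Nm <-]].
    exists (a *: c + e); first by case: sC => _; apply.
    exists (a *: n + m); first by case: sN => _; apply.
    by rewrite scalerDr addrACA.
  move=> _ _ [c Cc [n Nn <-]] [e Ce [m Nm <-]].
  exists 0; first by case: sC.
  exists (lie (c + n) (e + m)); last by rewrite add0r.
  have Ee := CE _ Ce; have Ec := CE _ Cc; have Em : enveloping m by case: Nm.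
  rewrite -[c]scale1r lie_linearl scale1r; apply: subspaceD => //.
    rewrite -[e]scale1r lie_linearr scale1r; apply: subspaceD; auto.
    rewrite lieC -scaleN1r; apply: subspaceZ => //; exact: trace_radical_lie.
  apply: trace_radical_lie => //; rewrite -[e]scale1r; exact: enveloping_lin.
have nilH h : H h -> nilpotent_mx h.
  move=> [c Cc [n Nn <-]]; have [k ck] := nilC _ Cc.
  have Ec := CE _ Cc; have En : enveloping n by case: Nn.
  have Ecn : enveloping (c + n) by rewrite -[c]scale1r; apply: enveloping_lin.
  have Nk j : N ((c + n) ^+ j - c ^+ j).
    elim: j => [|j IHj]; first by rewrite subrr; case: sN.
    have -> : (c + n) ^+ j.+1 - c ^+ j.+1 =
              ((c + n) ^+ j - c ^+ j) *m c + (c + n) ^+ j *m n.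
      by rewrite !exprSr mulmxBl addrAC -mulmxDr.
    apply: subspaceD => //; first exact: trace_radical_mulr.
    by apply: trace_radical_mull => //; apply: enveloping_exp.
  have := Nk k; rewrite ck subr0 => /trace_radical_nilpotent [m nm].
  by exists (k * m)%N; rewrite exprM.
have [k Hk] := engel aH nilH.
have stab u i v : enveloping u -> flag natrep H i v -> flag natrep H i (v *m u).
  have sf := subspace_flag natrep H i.
  move=> Eu; elim: Eu v => {u} [s Ss|//|a u w _ IHu _ IHw|u w _ IHu _ IHw] v Hv.
  - apply: flag_normalizer Hv => _ [c Cc [n Nn <-]].
    exists (lie c s); first exact: idC.
    exists (lie n s); first by apply: trace_radical_lie => //; apply: enveloping_gen.
    by rewrite -[c + n](congr1 (+%R^~ n) (scale1r c)) lie_linearl scale1r.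
  - by rewrite mulmx1.
  - by rewrite mulmxDr -scalemxAr; case: sf => _; apply; auto.
  - by rewrite mulmxA; auto.
move=> c Cc; split=> [|u Eu]; first exact: CE.
apply: nilpotent_mxtrace; exists k; apply: natrep_faithful => v; apply: Hk.
elim: k => [//|k IHk].
have -> : natrep ((c *m u) ^+ k.+1) v = natrep c (natrep ((c *m u) ^+ k) v) *m u.
  by rewrite !natrepE exprSr -[X in v *m X]/(_ *m _) !mulmxA.
apply: stab => //; apply: (flag_act IHk).
by exists c => //; exists 0; [case: sN|rewrite addr0].
Qed.

(** By the Jacobi identity ad s is a derivation. *)
Lemma derived_ideal (D : set 'M[F]_d) :
  (forall z s, D z -> S s -> D (lie z s)) ->
  forall z s, derived D z -> S s -> derived D (lie z s).
Proof.
move=> idD z s + Ss; pose W := ad s @^-1` derived D.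
suff : derived D `<=` W by apply.
apply: lin_span_sub; first exact/subspace_preimage/subspace_lin_span.
move=> _ [x [y [Dx Dy ->]]]; rewrite /W /preimage /= /ad.
have -> : lie (lie x y) s = lie (lie x s) y + lie x (lie y s).
  have /eqP := lie_jacobi x y s; rewrite -addrA addr_eq0 => /eqP ->.
  rewrite opprD addrC [lie s x]lieC [lie (lie y s) x]lieC opprK.
  have := lie_linearl (-1) (lie x s) 0 y.
  by rewrite !scaleN1r addr0 => ->; rewrite -[lie 0 y]/(ad y 0) linear0 addr0 opprK.
apply: subspaceD (subspace_lin_span _) _ _; apply: sub_lin_span.
  by exists (lie x s), y; split; auto.
by exists x, (lie y s); split; auto.
Qed.

(** Descending along the derived series D i of J.  If the commutators of D i are
    in N, a sum c of brackets [z, a] with z in D i commutes with D i modulo N,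
    so tr([z, a] c^j) = tr(a [c^j, z]) = 0: c is nilpotent, and [D i, S] lies in N
    ([step1]).  If [D (i+1), S] lies in N, the same computation with the
    brackets that span D (i+1) shows that its elements are nilpotent, and
    D (i+1) lies in N ([step2]).  The trivial end of the series starts
    the descent. *)
Theorem lie_solvable_ideal_trace_radical (J : set 'M[F]_d) :
  subspace J -> J `<=` S -> (forall z s, J z -> S s -> J (lie z s)) ->
  solvable J -> forall z a, J z -> S a -> N (lie z a).
Proof.
move=> sJ JS idJ [k Jk]; have sN := subspace_trace_radical.
pose D i := iter i derived J.
have idD i z s : D i z -> S s -> D i (lie z s).
  by elim: i z s => [|i IHi] //; apply: derived_ideal.
have sD i : subspace (D i) by case: i => [//|i]; apply: subspace_lin_span.
have D_desc i : D i `<=` S -> D i.+1 `<=` D i.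
  by move=> DS; apply: lin_span_sub => // _ [x [y [Dx /DS Sy ->]]]; apply: idD.
have DS i : D i `<=` S.
  by elim: i => [//|i IHi]; apply: subset_trans (D_desc _ IHi) IHi.
have DE i c : D i c -> enveloping c by move/DS; apply: enveloping_gen.
have trace0 (G : set 'M[F]_d) c : lin_span G c ->
    (forall u i, G u -> \tr (u *m c ^+ i) = 0) -> nilpotent_mx c.
  move=> Gc G0; apply: nilpotent_mxtrace_expr => // i; rewrite exprS.
  apply: (lin_span_sub (subspace_mxtrace_mull (c ^+ i)) _ Gc) => u.
  exact: G0.
have step1 i : D i.+1 `<=` N -> forall z a, D i z -> S a -> N (lie z a).
  move=> DN z a Dz Sa.
  pose G := [set u | exists z a, [/\ D i z, S a & u = lie z a]].
  have GD : lin_span G `<=` D i.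
    by apply: lin_span_sub => // _ [y [b [Dy Sb ->]]]; apply: idD.
  suff : lin_span G `<=` N by apply; apply: sub_lin_span; exists z, a.
  apply: nil_ideal_sub_trace_radical.
  - exact: subspace_lin_span.
  - exact: subset_trans GD (DS i).
  - by move=> c s /GD Dc Ss; apply: sub_lin_span; exists c, s.
  - by move=> c e /GD Dc /GD De; apply/DN/sub_lin_span; exists c, e.
  move=> c Gc; apply: (trace0 _ _ Gc) => _ j [y [b [Dy Sb ->]]].
  have Dc := GD _ Gc.
  rewrite lieC mulNmx linearN /= mxtrace_lie lieC mulmxN linearN /= opprK.
  rewrite mxtrace_mulC; have [|_ ->] // := @trace_radical_lie_exp c y j (DE _ _ Dc) (DE _ _ Dy).
    by apply/DN/sub_lin_span; exists c, y.
  exact: enveloping_gen.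
have step2 i : (forall z a, D i.+1 z -> S a -> N (lie z a)) -> D i.+1 `<=` N.
  move=> DN; apply: nil_ideal_sub_trace_radical => //.
  - exact: idD.
  - by move=> c e Dc /DS Se; apply: DN.
  move=> c Dc; apply: (trace0 _ _ Dc) => _ j [x [y [Dx Dy ->]]].
  rewrite mxtrace_lie lieC mulmxN linearN /= mxtrace_mulC.
  have [|_ ->] := @trace_radical_lie_exp c y j (DE _ _ Dc) (DE _ _ Dy).
  - exact/DN/DS/Dy.
  - by rewrite oppr0.
  - exact: DE Dx.
suff : D 1%N `<=` N by apply: (step1 0).
have : D k.+1 `<=` N.
  apply: subset_trans (D_desc _ (DS k)) _; rewrite /D Jk => _ ->.
  by case: sN.
by elim: k {Jk} => [//|k IHk] /step1 /step2.
Qed.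

End EnvelopingAlgebra.

(** * The Fitting trace as a trace of matrices *)

(** With P = A^(-N), E = C P B is an idempotent commuting with X.  On its image X
    is conjugate to A, and X (1 - E) is nilpotent because
    X^N (1 - E) = C B - C P B C B = 0. *)
Lemma shift_equivalence_mxtrace (F : fieldType) n d (A : 'M[F]_n) (X : 'M[F]_d)
    (B : 'M_(n, d)) (C : 'M_(d, n)) N :
  A *m B = B *m X -> X *m C = C *m A -> B *m C = A ^+ N -> C *m B = X ^+ N ->
  row_free A -> \tr A = \tr X.
Proof.
move=> AB XC BC CB fA.
have [P PA AP] : exists2 P, P *m A ^+ N = 1%:M & A *m P = P *m A.
  have /row_freeP [Q AQ] := fA; have QA := mulmx1C AQ.
  exists (Q ^+ N); last first.
    apply: (commrX N (x := A)); rewrite /GRing.comm -!mulmxE.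
    by rewrite AQ QA.
  rewrite mulmxE -exprMn_comm; last by rewrite /GRing.comm -!mulmxE AQ QA.
  by rewrite -mulmxE QA expr1n.
have AP1 : A ^+ N *m P = 1%:M := mulmx1C PA.
pose E := C *m P *m B.
have XE : X *m E = E *m X.
  by rewrite /E !mulmxA XC -!mulmxA -AB !mulmxA -[C *m A *m P]mulmxA AP mulmxA.
have trXE : \tr (X *m E) = \tr A.
  rewrite /E !mulmxA XC mxtrace_mulC !mulmxA BC mxtrace_mulC mulmxA.
  by rewrite PA mul1mx.
apply/eqP; rewrite eq_sym -subr_eq0 -trXE -raddfB /=.
apply/eqP/nilpotent_mxtrace; exists N.+1.
have -> : X - X *m E = X *m (1%:M - E) by rewrite mulmxBr mulmx1.
rewrite mulmxE exprMn_comm; last first.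
  by rewrite /GRing.comm -!mulmxE mulmxBr mulmxBl mulmx1 mul1mx XE.
rewrite [X ^+ _]exprS [(_ - _) ^+ _]exprS -mulrA [X ^+ N * _]mulrA.
suff -> : X ^+ N * (1%:M - E) = 0 by rewrite mul0r mulr0.
rewrite mulrBr mulr1 -CB /E -[X in _ - X]/(_ *m _) !mulmxA.
by rewrite -[C *m B *m C]mulmxA BC -[C *m _ *m P]mulmxA AP1 mulmx1 subrr.
Qed.

Section LinearCombinations.
Context {F : fieldType} {V : lmodType F}.

Definition lincomb d (u : 'I_d -> V) (c : 'rV[F]_d) : V := \sum_i c 0 i *: u i.

Fact lincomb_linear d (u : 'I_d -> V) : linear (lincomb u).
Proof.
move=> a c e; rewrite /lincomb scaler_sumr -big_split; apply: eq_bigr => i _.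
by rewrite !mxE scalerDl scalerA.
Qed.

HB.instance Definition _ d (u : 'I_d -> V) :=
  GRing.isLinear.Build F 'rV[F]_d V *:%R (lincomb u) (lincomb_linear u).

Lemma lincomb_delta d (u : 'I_d -> V) i : lincomb u (delta_mx 0 i) = u i.
Proof.
rewrite /lincomb (bigD1 i) //= mxE !eqxx scale1r big1 ?addr0 // => j ji.
by rewrite mxE (negPf ji) andbF scale0r.
Qed.

Lemma lincomb_in (W : set V) d (u : 'I_d -> V) c :
  subspace W -> (forall i, W (u i)) -> W (lincomb u c).
Proof. by move=> sW Wu; apply: subspace_sum => // i _; apply: subspaceZ. Qed.

Lemma lincomb_mulmx d n (u : 'I_d -> V) (c : 'rV_n) (X : 'M_(n, d)) :
  lincomb u (c *m X) = \sum_i c 0 i *: lincomb u (row i X).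
Proof.
rewrite mulmx_sum_row linear_sum; apply: eq_bigr => i _; exact: linearZ.
Qed.

Definition spans_mod (U Z : set V) d (u : 'I_d -> V) :=
  (forall i, U (u i)) /\ (forall v, U v -> exists c, Z (v - lincomb u c)).

(** A spanning family of least size is free: a member with a non-zero
    coefficient in a relation could be dropped. *)
Lemma exists_free_spans_mod (U Z : set V) d (u : 'I_d -> V) :
  subspace Z -> spans_mod U Z u ->
  exists n (e : 'I_n -> V),
    spans_mod U Z e /\ (forall c, Z (lincomb e c) -> c = 0).
Proof.
move=> sZ spu.
pose P n := `[< exists e : 'I_n -> V, spans_mod U Z e >].
have P0 : exists n, P n by exists d; apply/asboolP; exists u.
case: (ex_minnP P0) => n /asboolP [e [Ue spe]] nmin; exists n, e; split=> // c Zc.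
apply/rowP => j; rewrite [RHS]mxE; apply: contrapT => /eqP cj.
case: n => [|n] in e Ue spe nmin c Zc j cj *; first by case: j cj.
suff /nmin : P n by rewrite ltnn.
apply/asboolP; exists (e \o lift j); split=> [i|v]; first exact: Ue.
move=> /spe [f Zf]; pose g := f - (f 0 j / c 0 j) *: c.
exists (col' j g).
have -> : lincomb (e \o lift j) (col' j g) = lincomb e g.
  rewrite /lincomb [RHS](bigD1_ord j) //= !mxE divfK // subrr scale0r add0r.
  by apply: eq_bigr => i _; rewrite !mxE.
rewrite /g linearB linearZ /= opprB addrCA addrC.
by apply: subspaceD => //; apply: subspaceZ.
Qed.

Definition is_basis (W : set V) d (u : 'I_d -> V) :=
  W = range (lincomb u) /\ injective (lincomb u).

Lemma exists_basis (W : set V) : subspace W -> finite_dim W ->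
  exists d (u : 'I_d -> V), is_basis W u.
Proof.
move=> sW [s Ws].
have [|d [u [[Wu spu] fu]]] :=
    @exists_free_spans_mod W [set 0] (size s) (nth 0 s) subspace_set0.
  split=> [i|v Wv]; first by rewrite Ws; apply/sub_lin_span/mem_nth.
  rewrite Ws in Wv; move: v Wv.
  pose W' := range (lincomb (fun i : 'I_(size s) => s`_i)).
  suff sW' : lin_span [set x | x \in s] `<=` W'.
    by move=> v /sW' [c _ <-]; exists c; rewrite subrr.
  apply: lin_span_sub.
    split; first by exists 0 => //; exact: linear0.
    move=> a _ _ [c _ <-] [e _ <-]; exists (a *: c + e) => //; exact: linearP.
  move=> x /= xs; have xi : (index x s < size s)%N by rewrite index_mem.
  by exists (delta_mx 0 (Ordinal xi)) => //; rewrite lincomb_delta nth_index.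
exists d, u; split.
  apply/seteqP; split=> [v /spu [c /eqP]|_ [c _ <-]]; last exact: lincomb_in.
  by rewrite subr_eq0 => /eqP ->; exists c.
move=> c e ce; apply/eqP; rewrite -subr_eq0; apply/eqP/fu.
by rewrite /= linearB /= ce subrr.
Qed.

(** X is the matrix of T in the family u, rows being images. *)
Definition represents (T : V -> V) d (u : 'I_d -> V) (X : 'M[F]_d) :=
  forall c, T (lincomb u c) = lincomb u (c *m X).

Lemma exists_represents (W : set V) d (u : 'I_d -> V) (T : {linear V -> V}) :
  is_basis W u -> (forall w, W w -> W (T w)) -> exists X, represents T u X.
Proof.
move=> [WE _] WT.
have /choice [X XP] : forall i, exists c, T (u i) = lincomb u c.
  move=> i; have : W (T (u i)).
    by apply: WT; rewrite WE; exists (delta_mx 0 i); rewrite ?lincomb_delta.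
  by rewrite WE => -[c _ <-]; exists c.
exists (\matrix_i X i) => c; rewrite lincomb_mulmx linear_sum.
by apply: eq_bigr => i _; rewrite rowK linearZ /= XP.
Qed.

Lemma represents_iter T d (u : 'I_d -> V) X k :
  represents T u X -> represents (iter k T) u (X ^+ k).
Proof.
move=> TX c; elim: k => [|k IHk]; first by rewrite mulmx1.
by rewrite iterS IHk TX exprSr -mulmxA.
Qed.

End LinearCombinations.

(** Fitting's lemma for matrices: once the rank of the powers has reached its
    minimum, both the row space and the left kernel are constant. *)
Lemma expr_stable_rank (F : fieldType) d (X : 'M[F]_d) :
  exists k, forall j, (X ^+ k <= X ^+ (k + j))%MS /\
    forall c : 'rV_d, c *m X ^+ (k + j) = 0 -> c *m X ^+ k = 0.
Proof.
have P0 : exists n, `[< exists k, \rank (X ^+ k) = n >].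
  by exists (\rank (X ^+ 0)); apply/asboolP; exists 0.
case: (ex_minnP P0) => n /asboolP [k <-] kmin; exists k => j.
have rk : (\rank (X ^+ k) <= \rank (X ^+ (k + j)))%N.
  by apply: kmin; apply/asboolP; exists (k + j)%N.
have subl : (X ^+ (k + j) <= X ^+ k)%MS by rewrite addnC exprD submxMl.
split; first by have := mxrank_leqif_sup subl => -[_ <-]; rewrite eqn_leq rk mxrankS.
move=> c /sub_kermxP ckj; apply/sub_kermxP; apply: submx_trans ckj _.
have subk : (kermx (X ^+ k) <= kermx (X ^+ (k + j)))%MS.
  by apply/sub_kermxP; rewrite exprD -mulmxE mulmxA mulmx_ker mul0mx.
have := mxrank_leqif_sup subk => -[_ <-].
by rewrite eqn_leq mxrankS //= !mxrank_ker leq_sub2l.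
Qed.

Section FittingTrace.
Context {F : fieldType} {V : lmodType F}.
Variables (T : {linear V -> V}) (W : set V) (d : nat) (u : 'I_d -> V) (X : 'M[F]_d).
Hypotheses (uW : is_basis W u) (TX : represents T u X).

Local Notation M0 := (fitting_null T).

Let iterT k : {linear V -> V} := iter k (fun f : {linear V -> V} => T \o f) idfun.

Let iterTE k v : iterT k v = iter k T v.
Proof. by elim: k => //= k ->. Qed.

Lemma fitting_nullP v : M0 v <-> exists k, iter k T v = 0.
Proof.
split=> [[k _ vk]|[k vk]]; first by exists k.
by exists k.+1 => //; rewrite iterS vk linear0.
Qed.

Let iterT0 k : iter k T 0 = 0. Proof. by rewrite -iterTE linear0. Qed.

Lemma subspace_fitting_null : subspace M0.
Proof.
split; first by apply/fitting_nullP; exists 0.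
move=> c x y /fitting_nullP [k xk] /fitting_nullP [l yl].
apply/fitting_nullP; exists (k + l)%N; rewrite -iterTE linearP !iterTE.
by rewrite addnC iterD xk iterT0 addnC iterD yl iterT0 scaler0 addr0.
Qed.

Lemma fitting_null_iter k v : M0 v <-> M0 (iter k T v).
Proof.
split=> /fitting_nullP [l vl]; apply/fitting_nullP.
  by exists l; rewrite -iterD addnC iterD vl iterT0.
by exists (l + k)%N; rewrite iterD.
Qed.

Hypothesis TW : exists m, forall v, W (iter m T v).

(** The null component may be infinite-dimensional, but T^m maps it into W, where
    the nilpotency is uniform. *)
Lemma fitting_bound : exists N,
  (forall v, M0 v -> iter N T v = 0) /\ (forall v, W (iter N T v)).
Proof.
have [WE ui] := uW; have [m mW] := TW; have [k kX] := expr_stable_rank X.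
exists (k + m)%N; split=> v; last first.
  have := mW v; rewrite WE => -[c _ cv]; exists (c *m X ^+ k) => //.
  by rewrite iterD -cv (represents_iter k TX).
move/(fitting_null_iter m)/fitting_nullP => [l].
rewrite iterD; have := mW v; rewrite WE => -[c _ <-].
rewrite !(represents_iter _ TX) => cl0.
have cl : c *m X ^+ l = 0 by apply: ui; rewrite cl0 linear0.
have [_ ->] := kX l; first exact: linear0.
by rewrite addnC exprD -mulmxE mulmxA cl mul0mx.
Qed.

(** A high power of T maps v into the stable image of T on W, so it agrees on v
    and on some element of W. *)
Lemma fitting_null_cofinite : spans_mod setT M0 u.
Proof.
have [WE ui] := uW; have [m mW] := TW; have [k kX] := expr_stable_rank X.
split=> // v _; have := mW v; rewrite WE => -[c _ cv].
have [/submxP [D XD] _] := kX m.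
exists (c *m D); apply/(fitting_null_iter (k + m)).
rewrite -iterTE linearB !iterTE (represents_iter _ TX).
by rewrite iterD -cv (represents_iter _ TX) -mulmxA -XD subrr; case: subspace_fitting_null.
Qed.

Let lincombE n (e : 'I_n -> V) (c : 'I_n -> F) :
  \sum_i c i *: e i = lincomb e (\row_i c i).
Proof. by apply: eq_bigr => i _; rewrite mxE. Qed.

(** For M0 the null component, the inclusion of W and T^N induce
    maps C : W -> V / M0 and B : V / M0 -> W which commute with T and whose two
    composites are T^N. *)
Lemma fitting_quotient_trace t : is_quotient_trace M0 T t -> t = \tr X.
Proof.
move=> [n [e [A [[spe fe] TA ->]]]]; have sM := subspace_fitting_null.
have [WE ui] := uW; have [N [N0 NW]] := fitting_bound.
have e_inj c1 c2 : M0 (lincomb e c1 - lincomb e c2) -> c1 = c2.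
  rewrite -linearB => Mc; apply/eqP; rewrite -subr_eq0; apply/eqP/rowP => i.
  by rewrite [RHS]mxE; apply: (fe (fun i => (c1 - c2) 0 i)).
have TM v : M0 v -> M0 (T v) by move/(fitting_null_iter 1).
have eqM_trans y x z : M0 (x - y) -> M0 (y - z) -> M0 (x - z).
  by move=> xy yz; rewrite -(subrK y x) -addrA; apply: subspaceD.
have eqM_sym x y : M0 (x - y) -> M0 (y - x).
  by move=> xy; rewrite -opprB -scaleN1r; apply: subspaceZ.
have eqM_T x y : M0 (x - y) -> M0 (T x - T y) by rewrite -linearB; apply: TM.
have TA' c : M0 (T (lincomb e c) - lincomb e (c *m A)).
  rewrite lincomb_mulmx linear_sum -sumrB; apply: subspace_sum => // i _.
  rewrite linearZ -scalerBr; apply: subspaceZ => //.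
  have -> : lincomb e (row i A) = \sum_j A i j *: e j.
    by apply: eq_bigr => j _; rewrite mxE.
  exact: TA.
have TAk k c : M0 (iter k T (lincomb e c) - lincomb e (c *m A ^+ k)).
  elim: k => [|k IHk]; first by rewrite mulmx1 subrr; case: sM.
  rewrite iterS exprSr -mulmxE mulmxA; apply: (eqM_trans _ _ _ _ (TA' _)).
  exact: eqM_T.
have /choice [C CP] : forall i, exists c, M0 (u i - lincomb e c).
  by move=> i; have [c] := spe (u i); rewrite lincombE; exists (\row_i c i).
pose Cm := \matrix_i C i.
have CE c : M0 (lincomb u c - lincomb e (c *m Cm)).
  rewrite lincomb_mulmx -sumrB; apply: subspace_sum => // i _.
  by rewrite -scalerBr; apply: subspaceZ => //; rewrite rowK.
have /choice [B BP] : forall i, exists c, iter N T (e i) = lincomb u c.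
  by move=> i; have := NW (e i); rewrite WE => -[c _ <-]; exists c.
pose Bm := \matrix_i B i.
have BE c : iter N T (lincomb e c) = lincomb u (c *m Bm).
  rewrite lincomb_mulmx -iterTE linear_sum; apply: eq_bigr => i _.
  by rewrite linearZ rowK /= iterTE BP.
have eqN x y : M0 (x - y) -> iter N T x = iter N T y.
  by move/N0/eqP; rewrite -iterTE linearB !iterTE subr_eq0 => /eqP.
have mx_ext p (Y Z : 'M[F]_(d, p)) : (forall c : 'rV_d, c *m Y = c *m Z) -> Y = Z.
  by move=> YZ; apply/row_matrixP => i; rewrite !rowE.
have mx_ext' p (Y Z : 'M[F]_(n, p)) : (forall c : 'rV_n, c *m Y = c *m Z) -> Y = Z.
  by move=> YZ; apply/row_matrixP => i; rewrite !rowE.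
apply: (shift_equivalence_mxtrace (B := Bm) (C := Cm) (N := N)).
- apply: mx_ext' => c; apply: ui; rewrite !mulmxA -BE -TX -BE.
  by rewrite -[RHS]/(iter N.+1 T _) iterSr; apply/esym/eqN.
- apply: mx_ext => c; apply: e_inj; rewrite !mulmxA.
  apply: (eqM_trans _ _ _ _ (TA' _)); apply: (eqM_sym); apply: (eqM_trans _ _ _ _ (CE _)).
  by rewrite -TX; apply: (eqM_T); apply: (eqM_sym).
- apply: mx_ext' => c; apply: e_inj; rewrite mulmxA.
  by apply: (eqM_trans _ _ _ _ (TAk N c)); rewrite BE; apply: (eqM_sym).
- apply: mx_ext => c; apply: ui; rewrite mulmxA -BE -(represents_iter _ TX).
  exact/esym/eqN.
apply: inj_row_free => c cA; apply: e_inj; rewrite linear0 subr0.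
apply/(fitting_null_iter 1); have := TA' c.
by rewrite cA linear0 subr0.
Qed.

Lemma exists_fitting_quotient_trace : exists t, is_quotient_trace M0 T t.
Proof.
have [n [e [[_ spe] fe]]] :=
  exists_free_spans_mod subspace_fitting_null fitting_null_cofinite.
have /choice [A AP] : forall i, exists c, M0 (T (e i) - lincomb e c) by move=> i; apply: spe.
exists (\tr (\matrix_i A i)), n, e, (\matrix_i A i); split=> //; first split.
- move=> v; have [c Mc] := spe v I; exists (c 0).
  rewrite lincombE; congr M0: Mc; congr (_ - lincomb e _).
  by apply/rowP => i; rewrite mxE.
- by move=> c; rewrite lincombE => /fe /rowP ci i; have := ci i; rewrite !mxE.
move=> i; have := AP i; congr M0; congr (_ - _); apply: eq_bigr => j _.
by rewrite mxE.
Qed.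

Theorem fitting_trace_represents : fitting_trace T = \tr X.
Proof.
apply: fitting_quotient_trace; rewrite /fitting_trace.
have [t tP] := exists_fitting_quotient_trace.
exact: (@xgetPex _ 0 [set t | is_quotient_trace M0 T t] (ex_intro _ t tP)).
Qed.

End FittingTrace.

(** * From representations to matrices *)
Lemma subspace_finite_dim (F : fieldType) (V : lmodType F) (U W : set V) :
  subspace W -> W `<=` U -> subspace U -> finite_dim U -> finite_dim W.
Proof.
move=> sW WU sU /(exists_basis sU) [d [u [UE _]]].
have [P PE] := subspace_vspace (subspace_preimage (lincomb u) sW).
have mP c : c \in P <-> W (lincomb u c).
  by rewrite -[c \in P : Prop]/([set c | c \in P] c) -PE.
exists [seq lincomb u c | c <- vbasis P]; apply/seteqP; split=> [w Ww|].
  have := WU _ Ww; rewrite UE => -[c _ cw].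
  have cP : c \in P by apply/mP; rewrite cw.
  rewrite -cw (coord_vbasis cP) linear_sum.
  apply: subspace_sum (subspace_lin_span _) _ => i _; rewrite linearZ.
  apply: subspaceZ (subspace_lin_span _) _; apply: sub_lin_span => /=.
  by apply/map_f/mem_nth; rewrite size_tuple.
by apply: lin_span_sub => // _ /= /mapP [c cP ->]; apply/mP/vbasis_mem.
Qed.

(** Elements of L and the matrices by which they act correspond to each other by
    a relation rather than a map: the matrix is only defined on A, and
    solvability is transported in both directions. *)
Section LieCorrespondence.
Context {F : fieldType} {L1 L2 : lieAlgType F}.
Variable rel : L1 -> L2 -> Prop.
Hypothesis rel0 : rel 0 0.
Hypothesis rel_lin : forall c a b x y,
  rel a x -> rel b y -> rel (c *: a + b) (c *: x + y).
Hypothesis rel_lie : forall a b x y,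
  rel a x -> rel b y -> rel (lie a b) (lie x y).

Lemma iter_derived_correspondence (B1 : set L1) (B2 : set L2) k a :
  (forall a, B1 a -> exists2 x, rel a x & B2 x) ->
  iter k derived B1 a -> exists2 x, rel a x & iter k derived B2 x.
Proof.
move=> B12; elim: k a => [//|k IHk] a.
suff : derived (iter k derived B1) `<=`
       [set a | exists2 x, rel a x & iter k.+1 derived B2 x] by apply.
have [D0 lD] := subspace_lin_span [set z | exists x y,
  [/\ iter k derived B2 x, iter k derived B2 y & z = lie x y]].
apply: lin_span_sub.
  split=> [|c b e [x bx Dx] [y ey Dy]]; first by exists 0.
  by exists (c *: x + y); [apply: rel_lin|apply: lD].
move=> _ [b [e [/IHk [x bx Dx] /IHk [y ey Dy] ->]]].
by exists (lie x y); [apply: rel_lie|apply: sub_lin_span; exists x, y].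
Qed.

Lemma subspace_correspondence (B : set L1) :
  subspace B -> subspace [set x | exists2 a, B a & rel a x].
Proof.
move=> [B0 lB]; split=> [|c x y [a Ba ax] [b Bb bY]]; first by exists 0.
by exists (c *: a + b); [apply: lB|apply: rel_lin].
Qed.

End LieCorrespondence.

Section MatrixModel.
Context {F : fieldType} {L : lieAlgType F} {M : lmodType F}.
Variables (R : representation L M) (W : set M) (d : nat) (u : 'I_d -> M).
Hypothesis uW : is_basis W u.

Definition acts_as a (X : 'M[F]_d) := represents (R a) u X.

Lemma acts_as0 : acts_as 0 0.
Proof. by move=> c; rewrite rep0 mulmx0 linear0. Qed.

Lemma acts_as_lin c a b X Y :
  acts_as a X -> acts_as b Y -> acts_as (c *: a + b) (c *: X + Y).
Proof.
move=> aX bY e; rewrite rep_linear aX bY mulmxDr -scalemxAr.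
by rewrite linearP.
Qed.

Lemma acts_as_lie a b X Y :
  acts_as a X -> acts_as b Y -> acts_as (lie a b) (lie X Y).
Proof.
by move=> aX bY e; rewrite rep_lie !(aX, bY) natrep_lie linearB.
Qed.

Lemma acts_as0_eq0 X : acts_as 0 X -> X = 0.
Proof.
move=> X0; apply: natrep_faithful => v; apply: (proj2 uW).
by rewrite natrepE -X0 rep0 linear0.
Qed.

Variables (A : set L) (n : nat).
Hypothesis flagW : flag R A n `<=` W.

(** The k-th power of a^R b^R is a word of length 2k in A, so for k = n it maps
    M into M A^n. *)
Lemma trace_form_acts_as a b X Y : A a -> A b ->
  acts_as a X -> acts_as b Y -> trace_form R a b = \tr (X *m Y).
Proof.
move=> Aa Ab aX bY; apply: (fitting_trace_represents uW).
  by move=> c; rewrite /= aX bY mulmxA.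
exists n => v; apply/flagW; apply: (@flag_anti _ _ _ _ _ _ n.*2).
  by rewrite -addnn leq_addr.
elim: n => [//|m IHm]; rewrite iterS doubleS.
exact: flag_act (flag_act IHm Aa) Ab.
Qed.

End MatrixModel.

(** * The radical of the trace form *)
Section TraceFormRadical.
Context {F : fieldType} {L : lieAlgType F} {M : lmodType F}.
Hypothesis char0 : [pchar F] =i pred0.
Variable R : representation L M.

(** What both parts provide, with W = M A^n in the first and W = A in the
    second: any finite set of elements acts by matrices on a space W that
    carries their trace form. *)
Definition locally_matricial := forall s : seq L,
  exists (A : set L) (n d : nat) (u : 'I_d -> M) (W : set M),
  [/\ subalgebra A, forall x, x \in s -> A x, is_basis W u,
      flag R A n `<=` W & forall a, A a -> exists X, acts_as R u a X].

Hypothesis locM : locally_matricial.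

Lemma trace_form_lin c a x y :
  trace_form R a (c *: x + y) = c * trace_form R a x + trace_form R a y.
Proof.
have [A [n [d [u [W [[[_ lA] _] sA uW fW mA]]]]]] := locM [:: a; x; y].
have {sA} [Aa Ax Ay] : [/\ A a, A x & A y].
  by split; apply: sA; rewrite !inE eqxx ?orbT.
have [[Xa aX] [X xX] [Y yY]] := And3 (mA _ Aa) (mA _ Ax) (mA _ Ay).
have tr := trace_form_acts_as uW fW.
rewrite (tr _ _ _ _ Aa (lA _ _ _ Ax Ay) aX (acts_as_lin c xX yY)).
rewrite (tr _ _ _ _ Aa Ax aX xX) (tr _ _ _ _ Aa Ay aX yY).
by rewrite mulmxDr -scalemxAr linearD linearZ.
Qed.

Lemma trace_formC a b : trace_form R a b = trace_form R b a.
Proof.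
have [A [n [d [u [W [_ sA uW fW mA]]]]]] := locM [:: a; b].
have [Aa Ab] : A a /\ A b by split; apply: sA; rewrite !inE eqxx ?orbT.
have [[X aX] [Y bY]] := conj (mA _ Aa) (mA _ Ab).
have tr := trace_form_acts_as uW fW.
by rewrite (tr _ _ _ _ Aa Ab aX bY) (tr _ _ _ _ Ab Aa bY aX) mxtrace_mulC.
Qed.

Lemma trace_form_lie a b c :
  trace_form R (lie a b) c = trace_form R a (lie b c).
Proof.
have [A [n [d [u [W [[_ lA] sA uW fW mA]]]]]] := locM [:: a; b; c].
have {sA} [Aa Ab Ac] : [/\ A a, A b & A c].
  by split; apply: sA; rewrite !inE eqxx ?orbT.
have [[X aX] [Y bY] [Z cZ]] := And3 (mA _ Aa) (mA _ Ab) (mA _ Ac).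
have tr := trace_form_acts_as uW fW.
rewrite (tr _ _ _ _ (lA _ _ Aa Ab) Ac (acts_as_lie aX bY) cZ).
rewrite (tr _ _ _ _ Aa (lA _ _ Ab Ac) aX (acts_as_lie bY cZ)).
exact: mxtrace_lie.
Qed.

Lemma trace_form0 a : trace_form R a 0 = 0.
Proof.
by have := trace_form_lin (-1) a 0 0; rewrite scaler0 addr0 mulN1r addNr.
Qed.

Definition form_radical : set L := [set z | forall a, trace_form R a z = 0].

Lemma form_radical_ideal : lie_ideal form_radical.
Proof.
split; first split.
- by move=> a; apply: trace_form0.
- by move=> c x y x0 y0 a; rewrite trace_form_lin x0 y0 mulr0 addr0.
move=> x y x0 a; rewrite lieC -scaleN1r -[_ *: _]addr0 trace_form_lin.
by rewrite -trace_form_lie x0 mulr0 add0r trace_form0.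
Qed.

(** Cartan's criterion applies on W to the part B of the radical in A.  What it
    leaves is a term of the derived series of B that kills W, hence has a finite
    flag on M. *)
Lemma locally_solvable_form_radical :
  faithful R -> locally_solvable form_radical.
Proof.
move=> fR s sN; have [A [n [d [u [W [[sA lA] As uW fW mA]]]]]] := locM s.
have [sN0 idN] := form_radical_ideal.
pose B := A `&` form_radical.
have aB : subalgebra B.
  split; first exact: subspace_setI.
  by move=> x y [Ax Nx] [Ay Ny]; split; [apply: lA|apply: idN].
exists B; split=> // [x []//||x xs]; last by split; [apply: As|apply: sN].
pose Bm := [set X | exists2 a, B a & acts_as R u a X].
have aBm : subalgebra Bm.
  split; first exact: (subspace_correspondence (acts_as0 R u)
                         (@acts_as_lin _ _ _ R _ u) (proj1 aB)).
  move=> X Y [a Ba aX] [b Bb bY]; exists (lie a b); first exact: (proj2 aB).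
  exact: acts_as_lie.
have [k Dk] : solvable Bm.
  apply: cartan_criterion => // X Y [a [Aa _] aX] [b [Ab Nb] bY].
  by rewrite -(trace_form_acts_as uW fW Aa Ab aX bY).
have Dact a : iter k derived B a -> acts_as R u a 0.
  move=> /(iter_derived_correspondence (acts_as0 R u) (@acts_as_lin _ _ _ R _ u)
             (@acts_as_lie _ _ _ R _ u) (B2 := Bm)) [].
    by move=> b Bb; have [X bX] := mA b (proj1 Bb); exists X => //; exists b.
  by rewrite Dk => X aX X0; rewrite -X0.
have DB : iter k derived B `<=` A.
  move=> a Da; suff : B a by case.
  elim: (k) a Da => [//|j IHj] a /= Da; apply: derived_subalgebra aB _ _.
  exact: derived_sub IHj _ Da.
have [m Dm] : solvable (iter k derived B).
  apply: (@nil_flag_solvable _ _ _ R _ n.+1) => //.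
  apply: lin_span_sub subspace_set0 _ => _ [v [c [Dv Dc ->]]].
  have : W v.
    apply: fW; elim: (n) v Dv => [//|j IHj] v; apply: lin_span_mono.
    by move=> _ [w [e [Dw De ->]]]; exists w, e; split=> //; [exact: IHj|exact: DB].
  rewrite (proj1 uW) => -[e _ <-].
  by rewrite /= (Dact _ Dc e) mulmx0 linear0.
by exists (m + k)%N; rewrite iterD.
Qed.

End TraceFormRadical.

Lemma locally_matricial_of_rep_pow (F : fieldType) (L : lieAlgType F)
    (M : lmodType F) (R : representation L M) :
  locally_finite L ->
  (forall A : set L, subalgebra A -> finite_dim A ->
     exists2 n : nat, (0 < n)%N & finite_dim (rep_pow R A n)) ->
  locally_matricial R.
Proof.
move=> locfin fdR s; have [A [aA fA As]] := locfin s.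
have [n _ fn] := fdR A aA fA.
have fW : finite_dim (flag R A n).
  apply: subspace_finite_dim (@flag_sub_rep_pow _ _ _ R A n) _ fn.
    exact: subspace_flag.
  exact: subspace_lin_span.
have [d [u uW]] := exists_basis (subspace_flag R A n) fW.
exists A, n, d, u, (flag R A n); split=> // a Aa.
by apply: exists_represents uW _ => w Ww; apply/flagS/flag_act.
Qed.

(** * The Killing form and locally solvable ideals *)
Definition adjoint_condition (F : fieldType) (L : lieAlgType F) := forall s : seq L,
  exists A : set L, [/\ subalgebra A, finite_dim A, (forall x, x \in s -> A x)
    & exists2 n : nat, (0 < n)%N & rep_pow adjoint A n `<=` A].

Lemma exists_adjoint_model (F : fieldType) (L : lieAlgType F) (A : set L) n :
  subalgebra A -> finite_dim A -> rep_pow adjoint A n `<=` A ->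
  exists d (u : 'I_d -> L), [/\ is_basis A u, flag adjoint A n `<=` A
    & forall a, A a -> exists X, acts_as adjoint u a X].
Proof.
move=> [sA lA] fA An; have [d [u uA]] := exists_basis sA fA.
exists d, u; split=> // [|a Aa].
  exact: subset_trans (@flag_sub_rep_pow _ _ _ adjoint A n) An.
by apply: exists_represents uA _ => w Aw; apply: lA.
Qed.

Section SolvableIdeals.
Context {F : fieldType} {L : lieAlgType F}.
Hypothesis char0 : [pchar F] =i pred0.
Hypothesis adL : adjoint_condition L.

(** Inside A the ideal I becomes a solvable ideal, being spanned there by
    finitely many elements; so ad [z, a] acts on A by a matrix in the radical
    of the enveloping algebra. *)
Lemma killing_form_solvable_ideal (I : set L) (a b z : L) :
  lie_ideal I -> locally_solvable I -> I z -> killing_form (lie z a) b = 0.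
Proof.
move=> [sI idI] solI Iz.
have [A [aA fA As [n _ An]]] := adL [:: a; b; z].
have {As} [Aa Ab Az] : [/\ A a, A b & A z].
  by split; apply: As; rewrite !inE eqxx ?orbT.
have [d [u [uA flA mA]]] := exists_adjoint_model aA fA An.
have [sA lA] := aA.
pose J := A `&` I.
have sJ : subspace J by apply: subspace_setI.
have solJ : solvable J.
  have [s Js] : finite_dim J by apply: subspace_finite_dim fA => // ? [].
  have [x xs|B [[sB _] _ [k Bk] sB']] := solI s.
    by have [] : J x by rewrite Js; apply: sub_lin_span.
  exists k; apply/seteqP; split.
    rewrite -Bk; have JB : J `<=` B by rewrite Js; apply: lin_span_sub.
    by elim: (k) => [//|j IHj]; apply: derived_sub.
  move=> _ ->; suff [] : subspace (iter k derived J) by [].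
  by case: (k) => [//|j]; apply: subspace_lin_span.
pose S := [set X | exists2 e, A e & acts_as adjoint u e X].
pose Jm := [set X | exists2 e, J e & acts_as adjoint u e X].
have sJm : subspace Jm.
  exact: (subspace_correspondence (acts_as0 adjoint u) (@acts_as_lin _ _ _ adjoint _ u)).
have solJm : solvable Jm.
  have [k Jk] := solJ; exists k; apply/seteqP; split=> [X JX|_ ->].
    have [] := @iter_derived_correspondence _ _ _
        (fun X e => acts_as adjoint u e X) (acts_as0 adjoint u) _ _ Jm J k X _ JX.
    - by move=> c Y Z e f; apply: acts_as_lin.
    - by move=> Y Z e f; apply: acts_as_lie.
    - by move=> Y [e Je eY]; exists e.
    by move=> e eX; rewrite Jk => e0; rewrite e0 in eX; apply: acts_as0_eq0 uA _ eX.
  suff [] : subspace (iter k derived Jm) by [].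
  by case: (k) => [//|j]; apply: subspace_lin_span.
have [[X aX] [Y bY] [Z zZ]] := And3 (mA _ Aa) (mA _ Ab) (mA _ Az).
have NZX : trace_radical S (lie Z X).
  apply: (lie_solvable_ideal_trace_radical char0 sJm _ _ solJm).
  - by move=> V [e [Ae _] eV]; exists e.
  - move=> V V' [e [Ae Ie] eV] [f Af fV']; exists (lie e f).
      by split; [apply: lA|apply: idI].
    exact: acts_as_lie.
  - by exists z.
  - by exists a.
have /(proj2 NZX) : enveloping S Y by apply: enveloping_gen; exists b.
have Aza := lA _ _ Az Aa.
by move=> <-; apply: (trace_form_acts_as uA flA Aza Ab (acts_as_lie zZ aX) bY).
Qed.

Lemma locally_matricial_adjoint : locally_matricial (@adjoint F L).
Proof.
move=> s; have [A [aA fA As [n _ An]]] := adL s.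
have [d [u [uA flA mA]]] := exists_adjoint_model aA fA An.
by exists A, n, d, u, A.
Qed.

Lemma killing_form_central (a z : L) :
  (forall x, lie z x = 0) -> killing_form a z = 0.
Proof.
move=> z0.
have [A [n [d [u [W [_ As uW fW mA]]]]]] := locally_matricial_adjoint [:: a; z].
have [Aa Az] : A a /\ A z by split; apply: As; rewrite !inE eqxx ?orbT.
have [X aX] := mA _ Aa.
have zZ : acts_as adjoint u z 0.
  by move=> c; rewrite mulmx0 linear0 /= /ad lieC z0 oppr0.
by have := trace_form_acts_as uW fW Aa Az aX zZ; rewrite mulmx0 mxtrace0.
Qed.

End SolvableIdeals.

Theorem theorem4 (F : fieldType) (L : lieAlgType F)
  (charF0 : [pchar F] =i pred0) (locfinL : locally_finite L) :
  (semisimple L ->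
   forall (M : lmodType F) (R : representation L M),
     faithful R ->
     (forall A : set L, subalgebra A -> finite_dim A ->
        exists2 n : nat, (0 < n)%N & finite_dim (rep_pow R A n)) ->
     nondegenerate_form (trace_form R))
  /\
  ((forall s : seq L, exists A : set L,
      [/\ subalgebra A, finite_dim A, (forall x, x \in s -> A x)
        & exists2 n : nat, (0 < n)%N & rep_pow adjoint A n `<=` A]) ->
   nondegenerate_form (killing_form (L := L)) ->
   semisimple L).
Proof.
split=> [ssL M R fR fdR z z0|adL ndK I idI solI].
  have locM := locally_matricial_of_rep_pow locfinL fdR.
  have : form_radical R z by [].
  rewrite (ssL (form_radical R)) //; first exact: form_radical_ideal.
  exact: locally_solvable_form_radical.
apply/seteqP; split=> [z Iz|_ ->]; last by case: idI => -[].
have central x : lie z x = 0.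
  apply: ndK => b; rewrite killing_formE trace_formC.
    exact: killing_form_solvable_ideal idI solI Iz.
  exact: locally_matricial_adjoint.
by apply: ndK => a; apply: killing_form_central.
Qed.
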